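(* Let $G=N\rtimes H$ be a finite Frobenius group with kernel $N$ and complement $H$, where $|N|=q\ge 3$ and $|H|=q-1$, and let $\pi:G\to H$, $\pi(nh)=h$ for $n\in N$, $h\in H$, be the quotient map. A normal Cayley connection set $S\subset G\setminus\{1\}$ gives a Ramanujan graph $\operatorname{Cay}(G,S)$ if and only if $S$ is of one of the following forms: (i) $S=G\setminus\{1\}$; (ii) $S=G\setminus N$; (iii) $q\ge 5$ and $S=(N\setminus\{1\})\cup\pi^{-1}(H\setminus\{1,z\})$, where $z\in Z(H)$ is an involution; (iv) $S=\pi^{-1}(H\setminus K)$, where $K\triangleleft H$ has index two; (v) $q\ge 7$ and $S=\pi^{-1}\bigl((H\setminus K)\setminus\{z\}\bigr)$, where $K\triangleleft H$ has index two and $z\in Z(H)\setminus K$ is an involution. Descriptions that coincide in the smallest cases are counted only once.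
   Context: A finite group $G$ is a Frobenius group with kernel $N$ and complement $H$ if $G=N\rtimes H$ is a semidirect product in which $H$ acts on $N\setminus\{1\}$ without fixed points, that is, $C_N(h)=1$ for every $1\ne h\in H$. A normal Cayley connection set of $G$ is an inverse-closed generating set $S\subset G\setminus\{1\}$ that is a union of conjugacy classes of $G$. $\operatorname{Cay}(G,S)$ is the graph with vertex set $G$ in which $x,y$ are adjacent if and only if $x^{-1}y\in S$. A connected $d$-regular graph is Ramanujan if every adjacency eigenvalue $\lambda$ with $|\lambda|\ne d$ satisfies $|\lambda|\le 2\sqrt{d-1}$ (so for a bipartite graph both $d$ and $-d$ are regarded as trivial eigenvalues). An involution is an element of order two; $Z(H)$ is the center of $H$. *)

(* Defs.v *)
From mathcomp Require Import all_boot all_order all_algebra all_fingroup.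
From mathcomp Require Import all_solvable all_field.

Set Implicit Arguments.
Unset Strict Implicit.
Unset Printing Implicit Defensive.

Import Order.TTheory GroupScope GRing.Theory Num.Theory.

(* A graph on a finite vertex type V is given by its adjacency relation. *)

Definition connected_graph (V : finType) (e : rel V) : Prop :=
  forall x y : V, connect e x y.

Definition regular_graph (V : finType) (e : rel V) (d : nat) : Prop :=
  forall x : V, #|[set y | e x y]| = d.

(* An integer matrix has algebraic eigenvalues, so taking the entries in algC
   loses none of its complex eigenvalues. *)
Definition adjacency_mx (V : finType) (e : rel V) : 'M[algC]_#|V| :=
  (\matrix_(i, j) (e (enum_val i) (enum_val j))%:R)%R.

Definition ramanujan_graph (V : finType) (e : rel V) : Prop :=
  exists d : nat,
    [/\ connected_graph e,
        regular_graph e d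
      & forall a : algC,
          eigenvalue (adjacency_mx e) a ->
          (`|a| != d%:R)%R -> (`|a| <= 2 * sqrtC (d%:R - 1))%R].

Definition Cay (gT : finGroupType) (G : {group gT}) (S : {set gT}) :
    rel [subg G] :=
  fun x y => sgval (x^-1 * y) \in S.

Definition normal_connection_set (gT : finGroupType) (G : {group gT})
    (S : {set gT}) : Prop :=
  [/\ S \subset G^#,
      {in S, forall x, x^-1 \in S},
      <<S>> = G
    & exists2 C : {set {set gT}}, C \subset classes G & S = cover C].

Arguments Cay {gT} G S.

(* Main.v *)
Require Import Defs.
From mathcomp Require Import all_boot all_order all_algebra all_fingroup.
From mathcomp Require Import all_solvable all_field.
From mathcomp Require Import sesquilinear spectral zify ring lra.

Import GroupScope.

(** The group G is sharply 2-transitive, so N \ {1} is a single conjugacy class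
    and every other nontrivial class is a union of cosets of N: hence S is the
    preimage of some T in H \ {1}, with N \ {1} added (e = 1) or not (e = 0).
    Averaging over the cosets of N shows that the eigenvalues of Cay(G, S) are
    -e and e (q - 1) + q mu, with mu an eigenvalue of Cay(H, T).  For the listed
    sets these are found by hand.

    Conversely the spectral theorem turns the Ramanujan bound into
    |A f|^2 <= 4 (d - 1) |f|^2 for each f orthogonal to the eigenvectors of
    eigenvalue d or -d; the former are constant, and the latter are alternating
    functions, which come from a subgroup of index two disjoint from S.  Let U
    be the complement of T in H \ {1}.  A delta function as f bounds |U| by 3
    (by 2 if e = 0); in the bipartite case it bounds |(H \ K) \ T| by 1.
    The remaining large U are excluded by the indicator functions of U, of
    1 together with U, and of <U> when it is proper, and, if <U> = H is a cycle,
    by an alternating function. *)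

(** * The spectral bound on test functions *)

Section Spectral.

Import Order.TTheory GRing.Theory Num.Theory Num.Def.
Local Open Scope ring_scope.
Local Open Scope sesquilinear_scope.

(** In an orthonormal eigenbasis [A] multiplies each coordinate of [v] by an eigenvalue; either its
    squared modulus is at most [B], or the coordinate is zero because [v] is orthogonal to that
    eigenvector. *)
Lemma normalmx_norm_le (C : numClosedFieldType) n (A : 'M[C]_n)
    (v : 'rV[C]_n) (B : C) :
  A \is normalmx ->
  (forall a (w : 'rV[C]_n), w *m A = a *: w ->
     `|a| ^+ 2 <= B \/ v *m w ^t* = 0) ->
  (v *m A *m (v *m A) ^t*) 0 0 <= B * (v *m v ^t*) 0 0.
Proof.
move=> normA trivA; have /orthomx_spectralP defA := normA.
set P := spectralmx A in defA; set D := spectral_diag A in defA.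
have uP : P \is unitarymx by apply: spectral_unitarymx.
have uP' := unitarymx_unit uP.
have normP (x : 'rV_n) : (x *m P) *m (x *m P) ^t* = x *m x ^t*.
  by rewrite trmx_mul map_mxM /= mulmxA mulmxtVK.
have [c defv] : exists c, v = c *m P by exists (v *m invmx P); rewrite mulmxKV.
have defvA : v *m A = c *m diag_mx D *m P.
  by rewrite {1}defA defv !mulmxA mulmxK.
rewrite defvA {1 2}defv !normP mxE [X in _ <= _ * X]mxE mulr_sumr.
apply: ler_sum => i _; rewrite !mxE.
have -> : \sum_j c 0 j * diag_mx D j i = c 0 i * D 0 i.
  rewrite (bigD1 i) //= !mxE eqxx big1 ?addr0 // => j /negbTE neij.
  by rewrite !mxE neij mulr0n mulr0.
rewrite -!normCK normrM exprMn mulrC.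
have eigP : row i P *m A = D 0 i *: row i P.
  rewrite {1}defA !mulmxA -row_mul mulmxV // row1 -rowE row_diag_mx.
  by rewrite -scalemxAl -rowE.
case: (trivA _ _ eigP) => [leB | orth]; first by rewrite ler_wpM2r ?exprn_ge0.
have -> : c 0 i = 0; last by rewrite normr0 expr0n /= !mulr0.
(* Coordinate [i] of [c] is the Hermitian product of [v] with row [i] of [P]. *)
have -> : c = v *m P ^t* by rewrite defv mulmxtVK.
move/matrixP/(_ 0 0): orth; rewrite !mxE => orth; rewrite -[RHS]orth.
by apply: eq_bigr => k _; rewrite !mxE.
Qed.

Lemma norm_sub_sqr (C : numClosedFieldType) (u v z : C) : z * z^* = 1 ->
  `|u - z * v| ^+ 2 = `|u| ^+ 2 + `|v| ^+ 2 - (u * (z * v)^* + u^* * (z * v)).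
Proof.
move=> normz; rewrite !normCK rmorphB !rmorphM /=.
move: (u^*) (v^*) (z^*) normz => u' v' z' normz.
have -> : v * v' = (z * z') * (v * v') by rewrite normz mul1r.
by ring.
Qed.

End Spectral.

(** * Adjacency operators of Cayley graphs *)

Section CayleyGraph.

Import Order.TTheory GRing.Theory Num.Theory Num.Def.
Local Open Scope ring_scope.

Variables (gT : finGroupType) (G : {group gT}) (S : {set gT}).

Lemma sum_subg (R : nmodType) (F : gT -> R) :
  \sum_(i < #|{: subg_of G}|) F (sgval (enum_val i)) = \sum_(x in G) F x.
Proof.
rewrite -(big_enum_val (A := {: subg_of G}) (fun u => F (sgval u))) /=.
rewrite (reindex_onto (fun u : [subg G] => sgval u) (subg G)) /=; last first.
  by move=> x Gx; rewrite subgK.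
by apply: eq_bigl => u; rewrite subgP sgvalK eqxx.
Qed.


Definition rowfun (f : gT -> algC) : 'rV[algC]_#|{: subg_of G}| :=
  \row_i f (sgval (enum_val i)).

Lemma rowfunK (w : 'rV[algC]_#|{: subg_of G}|) :
  rowfun (fun x => w 0 (enum_rank (subg G x))) = w.
Proof. by apply/rowP => i; rewrite mxE sgvalK enum_valK. Qed.

Lemma dot_rowfun f g :
  (rowfun f *m map_mx conjC (rowfun g)^T) 0 0 = \sum_(x in G) f x * (g x)^*.
Proof.
rewrite -(sum_subg _ (fun x => f x * (g x)^*)) mxE.
by apply: eq_bigr => i _; rewrite !mxE.
Qed.

Hypotheses (sSG : S \subset G) (invS : {in S, forall x, x^-1%g \in S}).

Lemma memSV x : (x^-1%g \in S) = (x \in S).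
Proof. by apply/idP/idP => /invS; rewrite ?invgK. Qed.

(** Substituting [x = y * s] in the matrix product gives the condition [s^-1 \in S], which
    inverse-closure turns into [s \in S]. *)
Lemma rowfun_adjacency f :
  rowfun f *m adjacency_mx (Cay G S) =
  rowfun (fun y => \sum_(s in S) f (y * s)%g).
Proof.
apply/rowP => j; rewrite !mxE; set y := sgval _.
have Gy : y \in G by apply: subgP.
transitivity (\sum_(x in G) f x * (x^-1 * y \in S)%g%:R).
  rewrite -(sum_subg _ (fun x => f x * (x^-1 * y \in S)%g%:R)).
  by apply: eq_bigr => i _; rewrite !mxE.
rewrite (reindex_inj (mulgI y)) /= [RHS]big_mkcond [LHS]big_mkcond.
apply: eq_bigr => s _; rewrite invMg mulgKV memSV.
case: (boolP (s \in S)) => [Ss | _]; last by rewrite mulr0 if_same.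
by rewrite groupM // ?(subsetP sSG) // mulr1.
Qed.

Lemma cay_eigenfunction a :
  eigenvalue (adjacency_mx (Cay G S)) a ->
  exists2 f : gT -> algC, (exists2 y, y \in G & f y != 0)
    & {in G, forall y, \sum_(s in S) f (y * s)%g = a * f y}.
Proof.
case/eigenvalueP => w; rewrite -(rowfunK w); set f := fun x => _.
rewrite rowfun_adjacency => eig_f nz_f; exists f.
  have [/existsP[i nz_i] | /existsPn fi0] :=
    boolP [exists i, rowfun f 0 i != 0].
    by exists (sgval (enum_val i)); [apply: subgP | rewrite mxE in nz_i].
  by case/eqP: nz_f; apply/rowP => i; rewrite [RHS]mxE; apply/eqP/negPn/fi0.
move=> y Gy; move/rowP/(_ (enum_rank (subg G y))): eig_f.
by rewrite !mxE enum_rankK subgK.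
Qed.

Lemma cay_regular : regular_graph (Cay G S) #|S|.
Proof.
move=> x; rewrite -(card_imset _ (can_inj (@sgvalK _ G))).
rewrite -(card_imset S (mulgI (sgval x))); apply: eq_card => z.
apply/imsetP/imsetP => [[y xSy ->] | [s Ss ->]].
  by exists ((sgval x)^-1 * sgval y)%g; [rewrite inE in xSy | rewrite mulKVg].
have Gxs : (sgval x * s)%g \in G by rewrite groupM ?subgP ?(subsetP sSG).
exists (subg G (sgval x * s)%g); last by rewrite subgK.
rewrite inE /Cay; set u := subg G _;
  have -> : sgval (x^-1 * u)%g = ((sgval x)^-1 * sgval u)%g by [].
by rewrite subgK // mulKg.
Qed.

Hypothesis genS : <<S>>%g = G.

(** Every element of [G] is a word in [S], so properties spread from the identity letter by
    letter. *)
Lemma gen_mulr_ind (P : gT -> Prop) :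
    P 1%g -> (forall y s, y \in G -> s \in S -> P y -> P (y * s)%g) ->
  {in G, forall y, P y}.
Proof.
move=> P1 PM y; rewrite -genS => /gen_prodgP[n [c Sc ->]].
elim: n c Sc => [|n IHn] c Sc; first by rewrite big_ord0.
rewrite big_ord_recr /=; apply: PM => //; last by apply: IHn.
by apply: group_prod => i _; apply: (subsetP sSG).
Qed.

Lemma const_of_invariant (T : Type) (v : gT -> T) :
  {in G & S, forall y s, v (y * s)%g = v y} -> {in G, forall y, v y = v 1%g}.
Proof. by move=> inv_v; apply: gen_mulr_ind => // y s Gy Ss <-;
  apply: inv_v. Qed.

Lemma cay_connected : connected_graph (Cay G S).
Proof.
move=> x y; rewrite -[y](mulKVg x); set z := (x^-1 * y)%g.
rewrite -(sgvalK z).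
have: sgval z \in G by apply: subgP.
move: (sgval z); apply: gen_mulr_ind => [|g s Gg Ss con_g].
  rewrite (_ : subg G 1 = 1%g) ?mulg1 //.
  by apply: (can_inj (@sgvalK _ G)); rewrite subgK.
apply: connect_trans con_g (connect1 _).
rewrite /Cay.
have -> : sgval ((x * subg G g)^-1 * (x * subg G (g * s)))%g =
  ((sgval (subg G g))^-1 * sgval (subg G (g * s)))%g.
  by rewrite invMg -mulgA (mulKg (x : [subg G])).

have Gs: s \in G by apply: (subsetP sSG).
by rewrite (subgK g Gg) (subgK (g * s)%g (groupM Gg Gs)) mulKg.
Qed.

(** The equality case of the triangle inequality: with [z = a / #|S|] unimodular, the squared moduli
    of [f (y * s) - z * f y] add up to zero over all [y] and [s]. *)
Lemma extremal_eigenfunction (f : gT -> algC) (a : algC) :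
    {in G, forall y, \sum_(s in S) f (y * s)%g = a * f y} ->
    (0 < #|S|)%N -> `|a| = #|S|%:R ->
  {in G & S, forall y s, f (y * s)%g = a / #|S|%:R * f y}.
Proof.
move=> eig_f S_gt0 norm_a; set z := a / _.
have nzd : #|S|%:R != 0 :> algC by rewrite pnatr_eq0 -lt0n.
have def_a : a = #|S|%:R * z by rewrite mulrC divfK.
have normz : z * z^* = 1.
  by rewrite -normCK normf_div norm_a normr_nat divff // expr1n.
clearbody z.
have shift s (g : gT -> algC) :
    s \in S -> \sum_(y in G) g (y * s)%g = \sum_(y in G) g y.
  move=> Ss; rewrite [RHS](reindex_inj (mulIg s)) /=.
  by apply: eq_bigl => y; rewrite groupMr // (subsetP sSG).
(* For fixed [y] the eigenvalue equation evaluates the cross terms, leaving the squares at the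
   neighbours minus [#|S|] times the square at [y]; translation by [s] permutes [G], so the totals
   cancel. *)
have sum0 : \sum_(y in G) \sum_(s in S) `|f (y * s)%g - z * f y| ^+ 2 = 0.
  transitivity (\sum_(y in G) \sum_(s in S) (`|f (y * s)%g| ^+ 2
       + `|f y| ^+ 2 - (f (y * s)%g * (z * f y)^* +
         (f (y * s)%g)^* * (z * f y)))).
    apply: eq_bigr => y _; apply: eq_bigr => s _.
    exact: norm_sub_sqr.
  under eq_bigr => y Gy.
    rewrite sumrB !big_split /= -!mulr_suml -rmorph_sum eig_f //= sumr_const.
    rewrite (_ : _ - _ = \sum_(s in S) `|f (y * s)%g| ^+ 2 - #|S|%:R * `|f y|
      ^+ 2).
      over.
    rewrite -[_ *+ #|S|]mulr_natl -mulrA -expr2 def_a !normCK !rmorphM /=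
      rmorph_nat.
    move: (\sum_(s in S) _) #|S|%:R (f y) (f y)^* z^* normz =>
      t d v v' z' normz.
    have -> : d * z * v * (z' * v') =
      d * (v * v') by rewrite -[v * v']mul1r -normz; ring.
    have -> : d * z' * v' * (z * v) =
      d * (v * v') by rewrite -[v * v']mul1r -normz; ring.
    by ring.
  rewrite sumrB exchange_big /= (eq_bigr (fun=> \sum_(y in G) `|f y| ^+ 2)).
    by rewrite sumr_const -mulr_sumr mulr_natl subrr.
  by move=> s Ss; apply: (shift s (fun y => `|f y| ^+ 2)).
move=> y s Gy Ss; apply/eqP; rewrite -subr_eq0 -normr_eq0 -sqrf_eq0.
have ge0 x : 0 <= \sum_(s in S) `|f (x * s)%g - z * f x| ^+ 2.
  by apply: sumr_ge0 => s' _; rewrite exprn_ge0.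
move/eqP: sum0; rewrite psumr_eq0 // => /allP/(_ y); rewrite mem_index_enum Gy.
move=> /(_ isT)/=; rewrite psumr_eq0 => [/allP/(_ s)|? _];
  last exact: exprn_ge0.
by rewrite mem_index_enum Ss => /(_ isT).
Qed.

(** The last two hypotheses express orthogonality to the eigenvectors of eigenvalue [#|S|] and
    [- #|S|], which the Ramanujan bound exempts. Integer values keep the later estimates in integer
    arithmetic. *)
Lemma ramanujan_test (f : gT -> int) :
    ramanujan_graph (Cay G S) -> (0 < #|S|)%N -> \sum_(x in G) f x = 0 ->
    (forall w : gT -> algC, {in G & S, forall y s, w (y * s)%g = - w y} ->
       \sum_(x in G) (f x)%:~R * w x = 0) ->
  \sum_(y in G) (\sum_(s in S) f (y * s)%g) ^+ 2
    <= 4 * (#|S|%:Z - 1) * \sum_(x in G) f x ^+ 2.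
Proof.
case=> d [_ reg_d ram] S_gt0 sumf altf.
have def_d : d = #|S| by rewrite -(reg_d 1%g) -(cay_regular 1%g).
rewrite {}def_d {reg_d} in ram.
pose F x : algC := (f x)%:~R.
have symA : adjacency_mx (Cay G S) \is normalmx.
  apply: symmetric_normalmx; last first.
    by apply/mxOverP => i j; rewrite mxE realn.
  apply/is_hermitianmxP; rewrite expr0 scale1r; apply/matrixP => i j;
    rewrite !mxE /Cay.
  set u := enum_val i; set v := enum_val j.
  rewrite -(memSV (sgval (u^-1 * v)%g)); congr ((_ \in S)%:R).
  by rewrite -[RHS]/((sgval v)^-1 * sgval u)%g -[LHS]/((sgval u)^-1 * sgval
    v)^-1%g invMg invgK.
have d_ge1 : 0 <= #|S|%:R - 1 :> algC by rewrite subr_ge0 ler1n.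
have := normalmx_norm_le _ _ _ (rowfun F) (4 * (#|S|%:R - 1)) symA.
rewrite rowfun_adjacency !dot_rowfun => bound.
have sqF (g : gT -> int) :
    \sum_(x in G) (g x)%:~R * ((g x)%:~R)^* =
      (\sum_(x in G) g x ^+ 2)%:~R :> algC.
  by rewrite rmorph_sum; apply: eq_bigr => x _;
    rewrite /= rmorph_int rmorphXn expr2.
have sumF x : \sum_(s in S) F (x * s)%g = (\sum_(s in S) f (x * s)%g)%:~R.
  by rewrite rmorph_sum.
rewrite sqF (eq_bigr (fun x => (\sum_(s in S) f (x * s)%g)%:~R *
   ((\sum_(s in S) f (x * s)%g)%:~R)^*)) in bound; last by move=> x _;
     rewrite !sumF.
rewrite (sqF (fun x => \sum_(s in S) f (x * s)%g)) in bound.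
rewrite -(ler_int algC) !rmorphM rmorphB /= -pmulrn.
apply: bound => a w; rewrite -(rowfunK w); set g := fun x => _ => eig_g.
have eigg : {in G, forall y, \sum_(s in S) g (y * s)%g = a * g y}.
  move=> y Gy; rewrite rowfun_adjacency in eig_g.
  move/rowP/(_ (enum_rank (subg G y))): eig_g.
  by rewrite !mxE enum_rankK subgK.
have [norm_a | norm_a] := eqVneq `|a| #|S|%:R; last first.
  have [-> | nzg] := eqVneq (rowfun g) 0; first by right;
    rewrite trmx0 map_mx0 mulmx0.
  left; rewrite -[4]/(4%:R) (natrM _ 2 2) -expr2 -(sqrtCK (#|S|%:R - 1))
    -exprMn.
  rewrite lerXn2r ?nnegrE // ?mulr_ge0 ?sqrtC_ge0 //.
  by apply: ram => //; apply/eigenvalueP; exists (rowfun g).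
right; apply/matrixP => i j; rewrite !ord1 dot_rowfun mxE.
have ext := extremal_eigenfunction _ _ eigg S_gt0 norm_a.
move: (a / _) ext => z ext.
(* Stepping along [s] and back along [s^-1] multiplies by [z] twice; hence [z] is [1] or [-1] unless
   [g] vanishes on [G]. *)
have zz x : x \in G -> z * (z * g x) = g x.
  move=> Gx; have /card_gt0P[s Ss] := S_gt0.
  have Gs := subsetP sSG s Ss.
  by rewrite -(ext x s) // -(ext (x * s)%g s^-1%g) ?groupM ?invS // mulgK.
have [z1 | zN1] := eqVneq z 1.
  have const_g : {in G, forall x, g x = g 1%g}.
    by apply: const_of_invariant => y s Gy Ss; rewrite ext // z1 mul1r.
  under eq_bigr => x Gx do rewrite const_g //.
  by rewrite -mulr_suml -rmorph_sum sumf mul0r.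
have [/exists_inP[x Gx nz_gx] | /exists_inPn g0] :=
    boolP [exists x in G, g x != 0]; last first.
  by apply: big1 => x Gx; rewrite (eqP (negPn (g0 x Gx))) rmorph0 mulr0.
have /eqP : (z - 1) * (z + 1) = 0.
  apply: (mulIf nz_gx); rewrite (_ : _ * _ = z * z - 1); last by ring.
  by rewrite mulrBl mul1r -mulrA zz // subrr mul0r.
rewrite mulf_eq0 subr_eq0 (negbTE zN1) addr_eq0 => /eqP defz.
by apply: altf => y s Gy Ss; rewrite ext // defz mulN1r rmorphN.
Qed.

End CayleyGraph.

(** * Alternating functions and subgroups of index two *)

Section AlternatingFunctions.

Import Order.TTheory GRing.Theory Num.Theory.
Local Open Scope ring_scope.

Variables (gT : finGroupType) (G : {group gT}) (S : {set gT}).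
Hypotheses (sSG : S \subset G) (genS : <<S>>%g = G).

Lemma index2_mem (K : {group gT}) x y :
  K \subset G -> #|G : K|%g = 2%N -> x \in G -> y \in G :\: K ->
  ((x * y)%g \in K) = (x \notin K).
Proof.
move=> sKG iK Gx /setDP[Gy nKy].
have [Kx | nKx] := boolP (x \in K); first by rewrite groupMl // (negbTE nKy).
have : x \in (K :* y^-1)%g.
  by rewrite (rcoset_index2 sKG iK) ?inE ?groupV ?Gx ?nKx ?nKy.
by rewrite mem_rcoset invgK => ->.
Qed.

(** Up to the factor [w 1] such a function is a sign character of [G] equal to [-1] on [S]; [K] is
    its kernel. *)
Lemma alternating_index2 (w : gT -> algC) :
    (0 < #|S|)%N -> {in G & S, forall y s, w (y * s)%g = - w y} -> w 1%g != 0 ->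
  exists K : {group gT}, [/\ K <| G, #|G : K|%g = 2%N & S \subset G :\: K].
Proof.
move=> /card_gt0P[s Ss] alt_w nz_w1; have Gs := subsetP sSG s Ss.
have const := const_of_invariant _ _ _ sSG genS.
have w_sqr y : y \in G -> (w y == w 1%g) || (w y == - w 1%g).
  move=> Gy; rewrite -eqf_sqr; apply/eqP; move: y Gy.
  by apply: (const _ (fun y => w y ^+ 2)) => y t Gy St; rewrite alt_w // sqrrN.
have w_nz y : y \in G -> w y != 0.
  by move/w_sqr=> /orP[] /eqP->; rewrite ?oppr_eq0.
(* Both factors on the left change sign when [y] moves along [S], so their product is constant in
   [y]. *)
have wM x y : x \in G -> y \in G -> w (x * y)%g * w y = w x * w 1%g.
  move=> Gx Gy; rewrite -[in RHS](mulg1 x); move: y Gy.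
  apply: (const _ (fun y => w (x * y)%g * w y)) => y t Gy St.
  by rewrite mulgA (alt_w (x * y)%g t) ?(alt_w y t) ?groupM // mulrNN.
pose K := [set x in G | w x == w 1%g].
have gK : group_set K.
  apply/group_setP; split=> [|x y]; first by rewrite inE group1 /=.
  rewrite !inE => /andP[Gx /eqP wx] /andP[Gy /eqP wy]; rewrite groupM //=.
  by have := wM x y Gx Gy; rewrite wx wy => /(mulIf nz_w1)->.
have sKG : K \subset G by apply/subsetP=> x; rewrite inE => /andP[].
have nK x : x \in G :\: K -> w x = - w 1%g.
  rewrite !inE negb_and => /andP[/orP[/negP // | ne] Gx].
  by have := w_sqr x Gx; rewrite (negbTE ne) => /eqP.
have w1N : w 1%g != - w 1%g.
  by rewrite -addr_eq0 -mulr2n mulrn_eq0.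
have sSK : S \subset G :\: K.
  apply/subsetP=> t St; have Gt := subsetP sSG t St.
  by rewrite !inE Gt -[t]mul1g alt_w // eq_sym (negbTE w1N).
have cardK : #|G :\: K| = #|K|.
  rewrite -(card_imset K (mulIg s)); apply: eq_card => x.
  apply/idP/imsetP => [nKx | [y Ky ->]]; last first.
    move: Ky; rewrite !inE => /andP[Gy /eqP wy].
    by rewrite groupM //= alt_w // wy eq_sym (negbTE w1N).
  have Gx : x \in G by case/setDP: nKx.
  exists (x * s^-1)%g; last by rewrite mulgKV.
  rewrite inE groupM ?groupV //=; apply/eqP/oppr_inj.
  by rewrite -(alt_w (x * s^-1)%g s) ?groupM ?groupV // mulgKV nK.
have iK : #|G : Group gK|%g = 2%N.
  rewrite -divgS //= -(cardsID K G) cardK (setIidPr sKG) addnn -muln2.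
  by rewrite mulKn // (cardG_gt0 (Group gK)).
by exists (Group gK); split=> //; apply: index2_normal.
Qed.

End AlternatingFunctions.

(** * Connection sets of a sharply two-transitive group *)

Section FrobeniusKernelComplement.

Variables (gT : finGroupType) (G N H : {group gT}) (q : nat) (pi : gT -> gT).
Hypotheses (frobG : [Frobenius G = N ><| H]) (cardN : #|N| = q).
Hypothesis piE : {in N & H, forall n h, pi (n * h) = h}.

Let sdG : N ><| H = G. Proof. by have [] := Frobenius_context frobG. Qed.
Let sNG : N \subset G.
Proof. by have [/andP[]] := sdprod_context sdG. Qed.
Let sHG : H \subset G. Proof. by have [] := sdprod_context sdG. Qed.
Let nNG : G \subset 'N(N).
Proof. by have [/andP[]] := sdprod_context sdG. Qed.
Let inN x : x \in N -> x \in G. Proof. exact: (subsetP sNG). Qed.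
Let inH x : x \in H -> x \in G. Proof. exact: (subsetP sHG). Qed.

Lemma frob_decomp x : x \in G -> exists2 n, n \in N & x = n * pi x.
Proof.
have [_ _ <- _ _] := sdprod_context sdG => /mulsgP[n h Nn Hh ->].
by exists n; rewrite ?piE.
Qed.

Lemma pi_in x : x \in G -> pi x \in H.
Proof.
have [_ _ <- _ _] := sdprod_context sdG => /mulsgP[n h Nn Hh ->].
by rewrite piE.
Qed.

Lemma pi_compl h : h \in H -> pi h = h.
Proof. by move=> Hh; rewrite -{1}[h]mul1g piE. Qed.

Lemma pi_ker n : n \in N -> pi n = 1.
Proof. by move=> Nn; rewrite -[n]mulg1 piE. Qed.

Lemma piM : {in G &, {morph pi : x y / x * y}}.
Proof.
move=> x y Gx Gy; have [n Nn def_x] := frob_decomp x Gx.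
have [m Nm def_y] := frob_decomp y Gy.
have [Hx Hy] := (pi_in x Gx, pi_in y Gy).
have -> : x * y = n * m ^ (pi x)^-1 * (pi x * pi y).
  by rewrite {1}def_x {1}def_y conjgE invgK !mulgA mulgKV.
have NmJ : m ^ (pi x)^-1 \in N by rewrite memJ_norm // (subsetP nNG) // groupV
  inH.
by rewrite piE //; apply: groupM.
Qed.

Lemma pi_eq1 x : x \in G -> (pi x == 1) = (x \in N).
Proof.
move=> Gx; apply/eqP/idP => [pix1 | /pi_ker //].
by have [n Nn] := frob_decomp x Gx; rewrite pix1 mulg1 => ->.
Qed.

Lemma card_pi_fiber h : h \in H -> #|[set x in G | pi x == h]| = q.
Proof.
move=> Hh; rewrite -cardN -(card_rcoset N h); apply: eq_card => x.
rewrite inE mem_rcoset; apply/andP/idP => [[Gx /eqP <-] | Nxh].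
  by have [n Nn def_x] := frob_decomp x Gx; rewrite {1}def_x mulgK.
have Gx : x \in G by rewrite -[x](mulgKV h); apply: groupM;
  [apply: inN | apply: inH].
by split=> //; apply/eqP; rewrite -[x](mulgKV h); apply: piE.
Qed.

Lemma sum_pi (R : nmodType) (P : pred gT) (F : gT -> R) :
  (\sum_(x in G | P (pi x)) F (pi x) = (\sum_(h in H | P h) F h) *+ q)%R.
Proof.
rewrite (partition_big pi (fun h => (h \in H) && P h)) /= => [|x]; last first.
  by case/andP=> Gx ->; rewrite pi_in.
rewrite -GRing.sumrMnl; apply: eq_bigr => h /andP[Hh Ph].
rewrite (eq_bigr (fun=> F h)) => [|x /andP[_ /eqP-> //]].
rewrite -(card_pi_fiber h Hh) -GRing.sumr_const; apply: eq_bigl => x.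
by rewrite inE; case: eqP => [->|]; rewrite ?Ph ?andbT ?andbF.
Qed.

Variable S : {set gT}.
Hypothesis connS : normal_connection_set G S.

Let T := S :&: H.

Lemma conn_sub : S \subset G.
Proof. by have [/subset_trans-> //] := connS; apply: subsetDl. Qed.

Lemma conn_inv : {in S, forall x, x^-1 \in S}.
Proof. by have [] := connS. Qed.

Lemma conn_gen : <<S>> = G.
Proof. by have [] := connS. Qed.

Lemma conn_neq1 : 1 \notin S.
Proof.
by apply/negP=> S1; have [/subsetP/(_ 1 S1)] := connS; rewrite !inE eqxx.
Qed.

Lemma conn_conj x g : x \in S -> g \in G -> x ^ g \in S.
Proof.
have [_ _ _ [C sCG ->]] := connS => /bigcupP[A CA Ax] Gg.
apply/bigcupP; exists A => //; have /imsetP[y Gy defA] := subsetP sCG A CA.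
by move: Ax; rewrite defA => /class_eqP <-; apply: memJ_class.
Qed.

(** As [C_N(h) = 1] for [h = pi x], there are [#|N|] conjugates of [h] under [N], and they fill the
    coset [N h]; a union of classes contains all or nothing of it. *)
Lemma conn_coset x : x \in G -> pi x != 1 -> (x \in S) = (pi x \in S).
Proof.
move=> Gx ntpi; have Hpi := pi_in x Gx; have Gpi := inH _ Hpi.
have regpi : 'C_N[pi x] = 1.
  by apply: (Frobenius_reg_ker frobG); rewrite !inE ntpi.
have classN : (pi x) ^: N = N :* pi x.
  apply/eqP; rewrite eqEcard card_rcoset -index_cent1 regpi indexg1 leqnn andbT.
  apply/subsetP=> _ /imsetP[n Nn ->].
  rewrite mem_rcoset conjgE -!mulgA groupMl ?groupV //.
  rewrite (_ : _ * _ = n ^ (pi x)^-1) ?memJ_norm ?(subsetP nNG) ?groupV //.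
  by rewrite conjgE invgK mulgA.
have [n Nn def_x] := frob_decomp x Gx.
have /imsetP[m Nm def_m] : x \in pi x ^: N.
  by rewrite classN mem_rcoset {1}def_x mulgK.
have Gm := inN m Nm.
apply/idP/idP => [Sx | Spi]; last by rewrite def_m conn_conj.
by rewrite -(conjgK m (pi x)) -def_m conn_conj ?groupV.
Qed.

(** [H] acts freely on [N^#], which has exactly [#|H|] elements, so the action is transitive. *)
Lemma conn_ker : #|H| = q.-1 -> S :&: N = set0 \/ S :&: N = N^#.
Proof.
move=> cardH.
have [-> | [x /setIP[Sx Nx]]] := set_0Vmem (S :&: N); [by left | right].
have ntx : x != 1 by apply: contraTneq Sx => ->; apply: conn_neq1.
have regx : 'C_H[x] = 1.
  by apply: (Frobenius_reg_compl frobG); rewrite !inE ntx.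
have classH : x ^: H = N^#.
  apply/eqP; rewrite eqEcard -index_cent1 regx indexg1 cardH -cardN.
  rewrite (cardsD1 1 N) group1 leqnn andbT.
  apply/subsetP=> _ /imsetP[h Hh ->]; rewrite !inE conjg_eq1 ntx memJ_norm //.
  exact: (subsetP nNG) (inH h Hh).
apply/eqP; rewrite eqEsubset; apply/andP; split.
  apply/subsetP=> y /setIP[Sy Ny]; rewrite !inE Ny andbT.
  by apply: contraTneq Sy => ->; apply: conn_neq1.
rewrite -classH; apply/subsetP=> _ /imsetP[h Hh ->].
by rewrite inE conn_conj ?inH // memJ_norm // (subsetP nNG) ?inH.
Qed.

Lemma conn_compl_sub : T \subset H^#.
Proof.
apply/subsetP=> x /setIP[Sx Hx]; rewrite !inE Hx andbT.
by apply: contraTneq Sx => ->; apply: conn_neq1.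
Qed.

Lemma conn_setE : S = (S :&: N) :|: [set x in G | pi x \in T].
Proof.
apply/setP=> x; rewrite !inE.
have [Gx | nGx] /= := boolP (x \in G); last first.
  by rewrite (contraNF (subsetP conn_sub x) nGx).
rewrite pi_in // andbT -pi_eq1 //.
have [-> | ntpi] := eqVneq (pi x) 1; last by rewrite andbF -conn_coset.
by rewrite andbT (negbTE conn_neq1) orbF.
Qed.

(** Words in [S] are projected to [H]: letters in [N] become trivial, and by [conn_coset] all others
    land in [T]. *)
Lemma conn_compl_gen : <<T>> = H.
Proof.
apply/eqP; rewrite eqEsubset gen_subG subsetIr; apply/subsetP=> h Hh.
rewrite -(pi_compl h Hh).
have Gh := inH h Hh; move: h Gh {Hh}.
apply: (gen_mulr_ind _ G S conn_sub conn_gen) => [|y s Gy Ss Ty].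
  by rewrite pi_ker ?group1.
have Gs := subsetP conn_sub s Ss.
rewrite piM // groupM //; have [-> | nt] := eqVneq (pi s) 1;
  first exact: group1.
by rewrite mem_gen // inE pi_in // -conn_coset ?Ss.
Qed.

(** On functions pulled back along [pi] adjacency descends to [H]: letters in [N] fix the argument,
    and each [t] in [T] stands for a fiber of size [q]. *)
Lemma conn_sum (R : nmodType) (f : gT -> R) y : y \in G ->
  (\sum_(s in S) f (pi (y * s)%g) =
   f (pi y) *+ #|S :&: N| + (\sum_(t in T) f (pi y * t)%g) *+ q)%R.
Proof.
move=> Gy; rewrite (bigID (mem N)) /=; congr (_ + _)%R.
  rewrite -GRing.sumr_const; apply: eq_big => [s | s /andP[_ Ns]].
    by rewrite inE.
  by rewrite (piM y s Gy (inN s Ns)) (pi_ker s Ns) mulg1.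
rewrite [in RHS](eq_bigl (fun t => (t \in H) && (t \in T))) => [|t]; last first.
  by apply/idP/andP => [Tt | []//]; split; rewrite // (subsetP (subsetIr S H)).
rewrite -(sum_pi _ (fun t => t \in T) (fun t => f (pi y * t)%g)).
apply: eq_big => [s | s /andP[/(subsetP conn_sub) Gs _]];
  last by rewrite (piM y s Gy Gs).
rewrite {1}conn_setE !inE; have [Gs | nGs] /= := boolP (s \in G); last first.
  by rewrite orbF -andbA andbN andbF.
have [Ns | nNs] := boolP (s \in N); last by rewrite andbF andbT.
by rewrite (pi_ker s Ns) (negbTE conn_neq1) andbF.
Qed.

End FrobeniusKernelComplement.

(** * Reduction of the eigenvalues to the complement *)

Section FrobeniusEigenvalues.

Import Order.TTheory GRing.Theory Num.Theory Num.Def.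
Local Open Scope ring_scope.

Variables (gT : finGroupType) (G N H : {group gT}) (q : nat) (pi : gT -> gT).
Hypotheses (frobG : [Frobenius G = N ><| H]) (cardN : #|N| = q).
Hypothesis piE : {in N & H, forall n h, pi (n * h)%g = h}.
Variable S : {set gT}.
Hypothesis connS : normal_connection_set G S.

Let sSG := conn_sub _ _ _ connS.
Let sNG : N \subset G.
Proof. by have [/sdprod_context[/andP[]]] := Frobenius_context frobG. Qed.
Let sHG : H \subset G.
Proof. by have [/sdprod_context[]] := Frobenius_context frobG. Qed.
Let T := S :&: H.
Let pi_G := pi_in _ _ _ _ _ frobG piE.
Let pi_M := piM _ _ _ _ _ frobG piE.

Lemma sum_fiber_shift (f : gT -> algC) y h : y \in G -> h \in H ->
  \sum_(s in G | pi s == h) f (y * s)%g =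
  \sum_(x in G | pi x == (pi y * h)%g) f x.
Proof.
move=> Gy Hh; rewrite [RHS](reindex_inj (mulgI y)) /=; apply: eq_bigl => s.
rewrite groupMl //; case: (boolP (s \in G)) => //= Gs.
by rewrite pi_M // (inj_eq (mulgI _)).
Qed.

(* Averaging over the fibers of [pi] shows that an eigenfunction either has
   eigenvalue [- e] or is constant on the cosets of [N]. *)
Lemma frob_eigenvalue (e : bool) (a : algC) :
    S :&: N = (if e then N^# else set0) ->
    eigenvalue (adjacency_mx (Cay G S)) a ->
  a = - e%:R \/
  exists mu : algC, exists F : gT -> algC,
    [/\ exists2 h, h \in H & F h != 0,
        {in H, forall h, \sum_(t in T) F (h * t)%g = mu * F h}
      & a = e%:R * (q%:R - 1) + q%:R * mu].
Proof.
move=> defSN /(cay_eigenfunction _ _ _ sSG (conn_inv _ _ _ connS)).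
case=> f [y0 Gy0 nz_f] eig_f.
have [-> | aNe] := eqVneq a (- e%:R); [by left | right].
have ae : a + e%:R != 0 by rewrite addr_eq0.
pose M h := \sum_(x in G | pi x == h) f x.
pose g h := e%:R * M h + \sum_(t in T) M (h * t)%g.
(* If [e = 1], the elements of [N^#] contribute a fiber sum of [f] without the term [f y]; adding
   [e * f y] completes the fiber, so that only sums depending on [pi y] remain. *)
have eig_g y : y \in G -> (a + e%:R) * f y = g (pi y).
  move=> Gy; rewrite mulrDl -eig_f // (bigID (mem N)) /= addrAC; congr (_ + _).
    rewrite (eq_bigl (fun s => s \in S :&: N)) => [|s]; last by rewrite inE.
    rewrite defSN; case: e {defSN aNe ae g};
      last by rewrite big_set0 !mul0r addr0.
    rewrite !mul1r /M -[pi y]mulg1 -(sum_fiber_shift f y 1%g) //.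
    rewrite [in RHS](eq_bigl (fun s => s \in N)) => [|s]; last first.
      have [Ns|nNs] := boolP (s \in N).
        by rewrite (subsetP sNG) // (pi_ker _ _ _ _ piE s Ns) eqxx.
      apply: contraNF nNs => /andP[Gs].
      by rewrite (pi_eq1 _ _ _ _ _ frobG piE).
    rewrite [RHS](bigD1 1%g) //= mulg1 addrC; congr (_ + _).
    by apply: eq_bigl => s; rewrite !inE andbC.
  rewrite (partition_big pi (mem T)) /= => [|s /andP[Ss nNs]]; last first.
    have Gs := subsetP sSG s Ss.
    rewrite inE pi_G // -(conn_coset _ _ _ _ _ frobG piE _ connS) ?Ss //.
    by rewrite (pi_eq1 _ _ _ _ _ frobG piE).
  apply: eq_bigr => t Tt; have /setIP[St Ht] := Tt.
  rewrite /M -sum_fiber_shift //; apply: eq_bigl => s.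
  have [/eqP pis | _] := boolP (pi s == t); last by rewrite !andbF.
  have nt : pi s != 1%g.
    by rewrite pis; apply: contraTneq St => ->; apply: conn_neq1 connS.
  rewrite !andbT; have [Gs | nGs] := boolP (s \in G); last first.
    by rewrite (contraNF (subsetP sSG s) nGs).
  rewrite (conn_coset _ _ _ _ _ frobG piE _ connS) // pis St.
  by rewrite -(pi_eq1 _ _ _ _ _ frobG piE).
pose F h := g h / (a + e%:R).
have f_F y : y \in G -> f y = F (pi y).
  by move=> Gy; rewrite /F -eig_g // mulrC mulKf.
have M_F h : h \in H -> M h = q%:R * F h.
  move=> Hh; rewrite /M (eq_bigr (fun=> F h)) => [|x /andP[Gx /eqP <-]];
    last exact: f_F.
  rewrite mulr_natl -(card_pi_fiber _ _ _ _ _ _ frobG cardN piE h Hh)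
    -sumr_const.
  by apply: eq_bigl => x; rewrite !inE.
have nzq : q%:R != 0 :> algC by rewrite pnatr_eq0 -cardN -lt0n cardG_gt0.
pose mu := (a - e%:R * (q%:R - 1)) / q%:R.
exists mu, F; split; first by exists (pi y0); rewrite ?pi_G // -f_F.
  move=> h Hh; have Gh := subsetP sHG h Hh.
  have eqF : (a + e%:R) * F h = e%:R * (q%:R * F h) +
    \sum_(t in T) q%:R * F (h * t)%g.
    rewrite {1}/F mulrC divfK // /g M_F //; congr (_ + _).
    by apply: eq_bigr => t /setIP[_ Ht]; rewrite M_F ?groupM.
  rewrite -mulr_sumr in eqF; apply: (mulfI nzq);
    rewrite mulrA /mu [q%:R * (_ / _)]mulrC divfK //.
  apply: (addrI (e%:R * (q%:R * F h))); rewrite -eqF; ring.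
by rewrite /mu [q%:R * (_ / _)]mulrC divfK // addrC subrK.
Qed.

End FrobeniusEigenvalues.

(** * Spectra of the listed connection sets *)

Section SmallComplementSpectra.

Import Order.TTheory GRing.Theory Num.Theory Num.Def.
Local Open Scope ring_scope.

Variables (gT : finGroupType) (H : {group gT}).

Lemma sum_mulg (R : nmodType) (F : gT -> R) h : h \in H ->
  \sum_(t in H) F (h * t)%g = \sum_(x in H) F x.
Proof.
move=> Hh; rewrite [RHS](reindex_inj (mulgI h)) /=.
by apply: eq_bigl => t; rewrite groupMl.
Qed.

Lemma sum_mulgD1 (R : zmodType) (F : gT -> R) h : h \in H ->
  \sum_(t in H^#) F (h * t)%g = \sum_(x in H) F x - F h.
Proof.
move=> Hh; rewrite -(sum_mulg _ F h) // [in RHS](bigD1 1%g) //= mulg1 addrC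
  addrK.
by apply: eq_bigl => t; rewrite !inE andbC.
Qed.

Variables (T : {set gT}) (mu : algC) (F : gT -> algC).
Hypotheses (nzF : exists2 h, h \in H & F h != 0).
Hypothesis eigF : {in H, forall h, \sum_(t in T) F (h * t)%g = mu * F h}.

Lemma eigenvalue_of_const : T \subset H ->
  {in H, forall h, F h = F 1%g} -> mu = #|T|%:R.
Proof.
case: nzF => h Hh nzh sTH constF; apply: (mulIf nzh); rewrite -eigF //.
rewrite (constF h) // mulr_natl -sumr_const; apply: eq_bigr => t Tt.
by rewrite constF // groupM // (subsetP sTH).
Qed.

(** Here [(mu + 1) * F h] is the total of [F] over [H], so [F] is constant unless [mu = -1]. *)
Lemma eigenvalue_D1 : T = H^# -> mu = -1 \/ mu = #|T|%:R.
Proof.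
move=> defT; have [-> | muN1] := eqVneq mu (-1); [by left | right].
apply: eigenvalue_of_const; first by rewrite defT subsetDl.
have mu1 : mu + 1 != 0 by rewrite addr_eq0.
move=> h Hh; apply: (mulfI mu1); rewrite !mulrDl !mul1r -!eigF // defT.
by rewrite !sum_mulgD1 // !subrK.
Qed.

(** Here [(mu + 1) * F h + F (h * z)] is the total of [F]. Comparing [h] with [h * z] gives
    [F (h * z) = F h] unless [mu = 0]; then [(mu + 2) * F h] is constant. *)
Lemma eigenvalue_D1z z : z \in H -> #[z]%g = 2%N -> T = H :\: [set 1%g; z] ->
  [\/ mu = 0, mu = - 2 | mu = #|T|%:R].
Proof.
move=> Hz oz defT; have ntz : z != 1%g by rewrite -order_gt1 oz.
have zz : (z * z = 1)%g by have := expg_order z; rewrite oz.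
have eqF h : h \in H -> (mu + 1) * F h + F (h * z)%g = \sum_(x in H) F x.
  move=> Hh; rewrite mulrDl mul1r -eigF // -[RHS](subrK (F h)) -sum_mulgD1 //.
  rewrite addrAC; congr (_ + _); rewrite [RHS](bigD1 z) /=;
    last by rewrite !inE ntz.
  rewrite addrC defT; congr (_ + _); apply: eq_bigl => t.
  by rewrite !inE; case: (t == 1%g); case: (t == z); case: (t \in H).
have [-> | mu0] := eqVneq mu 0; first by constructor 1.
have [-> | mu2] := eqVneq mu (- 2); first by constructor 2.
have invF h : h \in H -> F (h * z)%g = F h.
  move=> Hh; apply: (mulfI mu0); have := eqF _ (groupM Hh Hz).
  rewrite -mulgA zz mulg1 -(eqF h) // => e.
  apply/eqP; rewrite -subr_eq0; apply/eqP; move/eqP: e;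
    rewrite -subr_eq0 => /eqP <-.
  by ring.
constructor 3; apply: eigenvalue_of_const; first by rewrite defT subsetDl.
have mu2' : mu + 2 != 0 by rewrite addr_eq0.
move=> h Hh; apply: (mulfI mu2').
have eq2 x : x \in H -> (mu + 2) * F x = \sum_(x in H) F x.
  by move=> Hx; rewrite -(eqF x) // invF //; ring.
by rewrite !eq2.
Qed.

Variable K : {group gT}.
Hypotheses (sKH : K \subset H) (iK : #|H : K|%g = 2%N).

Lemma sum_mulg_coset h : h \in H ->
  \sum_(t in H :\: K) F (h * t)%g =
  if h \in K then \sum_(x in H :\: K) F x else \sum_(x in K) F x.
Proof.
move=> Hh; transitivity (\sum_(x in H | (x \in K) != (h \in K)) F x).
  rewrite [RHS](reindex_inj (mulgI h)) /=; apply: eq_bigl => t.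
  rewrite groupMl // inE andbC; case: (boolP (t \in H)) => //= Ht.
  have [Kt | nKt] := boolP (t \in K); first by rewrite groupMr // eqxx.
  rewrite (index2_mem _ H K) ?inE ?nKt //; by case: (h \in K).
case: ifP => Kh; apply: eq_bigl => x; rewrite ?inE.
  by rewrite andbC; case: (x \in K).
by case: (boolP (x \in K)) => [/(subsetP sKH)-> | ]; rewrite ?andbF.
Qed.

(** Elements of [T] exchange the two cosets, so [mu * u = #|T| * v] and [mu * v = #|T| * u]. *)
Lemma eigenvalue_two_valued u v : T \subset H :\: K ->
    {in H, forall h, F h = if h \in K then u else v} ->
  mu ^+ 2 = #|T|%:R ^+ 2.
Proof.
move=> sT twoF.
have eqF h : h \in H -> mu * F h = #|T|%:R * (if h \in K then v else u).
  move=> Hh; rewrite -eigF // mulr_natl -sumr_const; apply: eq_bigr => t Tt.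
  have Tt' := subsetP sT t Tt; have Ht : t \in H by case/setDP: Tt'.
  rewrite (twoF (h * t)%g (groupM Hh Ht)) (index2_mem _ H K) //.
  by case: (h \in K).
case: nzF => h Hh nzh; apply: (mulIf nzh).
have [s Hs] : exists2 s, s \in H & (s \in K) = (h \notin K).
  have [Kh | nKh] := boolP (h \in K); last by exists 1%g; rewrite ?group1.
  have /subsetPn[s Hs nKs] : ~~ (H \subset K).
    by rewrite -indexg_eq1 iK.
  by exists s; rewrite // (negbTE nKs).
move=> Ks; rewrite !expr2 -!mulrA eqF // mulrCA.
have -> : mu * (if h \in K then v else u) = mu * F s by rewrite twoF // Ks;
  case: (h \in K).
by rewrite eqF // Ks twoF //; case: (h \in K).
Qed.

Lemma eigenvalue_coset : T = H :\: K -> mu = 0 \/ mu ^+ 2 = #|T|%:R ^+ 2.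
Proof.
move=> defT; have [-> | mu0] := eqVneq mu 0; [by left | right].
apply: (eigenvalue_two_valued ((\sum_(x in H :\: K) F x) / mu)
  ((\sum_(x in K) F x) / mu)); first by rewrite defT.
move=> h Hh; apply: (mulfI mu0); rewrite -eigF // defT sum_mulg_coset //.
by case: ifP; rewrite mulrC divfK.
Qed.

(** Adding [z] back, [mu * F h + F (h * z)] depends only on the coset of [h]. Eliminating
    [F (h * z)] by the same equation at [h * z] shows the same for [(mu ^+ 2 - 1) * F h]. *)
Lemma eigenvalue_coset_D1 z : z \in H :\: K -> #[z]%g = 2%N ->
  T = (H :\: K) :\ z -> mu ^+ 2 = 1 \/ mu ^+ 2 = #|T|%:R ^+ 2.
Proof.
move=> HKz oz defT; have [-> | mu1] := eqVneq (mu ^+ 2) 1; [by left | right].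
have /setDP[Hz nKz] := HKz.
have zz : (z * z = 1)%g by have := expg_order z; rewrite oz.
pose g (b : bool) := if b then \sum_(x in H :\: K) F x else \sum_(x in K) F x.
have eqF h : h \in H -> mu * F h + F (h * z)%g = g (h \in K).
  move=> Hh; rewrite -eigF // /g -sum_mulg_coset // [RHS](bigD1 z) //= addrC.
  by rewrite defT; congr (_ + _); apply: eq_bigl => t; rewrite !inE andbC.
have mu1' : mu ^+ 2 - 1 != 0 by rewrite subr_eq0.
apply: (eigenvalue_two_valued ((mu * g true - g false) / (mu ^+ 2 - 1))
  ((mu * g false - g true) / (mu ^+ 2 - 1))).
  by rewrite defT subsetDl.
move=> h Hh; apply: (mulfI mu1').
have e1 := eqF h Hh; have := eqF (h * z)%g (groupM Hh Hz).
rewrite -mulgA zz mulg1 (index2_mem _ H K) // => e2.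
transitivity (mu * g (h \in K) - g (h \notin K)); first by rewrite -e1 -e2;
  ring.
by case: (h \in K); rewrite /= [RHS]mulrC divfK.
Qed.

End SmallComplementSpectra.

(** * The listed sets give Ramanujan graphs *)

Section Forward.

Import Order.TTheory GRing.Theory Num.Theory Num.Def.
Local Open Scope ring_scope.

Variables (gT : finGroupType) (G N H : {group gT}) (q : nat) (pi : gT -> gT).
Hypotheses (frobG : [Frobenius G = N ><| H]) (cardN : #|N| = q).
Hypothesis piE : {in N & H, forall n h, pi (n * h)%g = h}.

Let sNG : N \subset G.
Proof. by have [/sdprod_context[/andP[]]] := Frobenius_context frobG. Qed.
Let sHG : H \subset G.
Proof. by have [/sdprod_context[]] := Frobenius_context frobG. Qed.
Let tiNH : N :&: H = 1%g.
Proof. by have [/sdprod_context[]] := Frobenius_context frobG. Qed.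

Definition pi_preim (A : {set gT}) : {set gT} := [set x in G | pi x \in A].

Lemma pi_preim_ker (A : {set gT}) : A \subset H^# -> pi_preim A :&: N = set0.
Proof.
move=> sAH; apply/setP=> x; rewrite !inE; apply/negbTE/negP.
case/andP=> /andP[_ Apx] Nx; have := subsetP sAH _ Apx.
by rewrite (pi_ker _ _ _ _ piE x Nx) !inE eqxx.
Qed.

Lemma pi_preim_compl (A : {set gT}) : A \subset H^# -> pi_preim A :&: H = A.
Proof.
move=> sAH; apply/setP=> x; rewrite !inE.
have [Hx | nHx] := boolP (x \in H).
  by rewrite andbT (pi_compl _ _ _ _ piE x Hx) (subsetP sHG).
by rewrite andbF; apply/esym/negbTE;
  apply: contra nHx => /(subsetP sAH)/setD1P[].
Qed.

Lemma setD_pi_preim : G :\: N = pi_preim H^#.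
Proof.
apply/setP=> x; rewrite !inE andbC; have [Gx | //] := boolP (x \in G).
by rewrite (pi_in _ _ _ _ _ frobG piE) // (pi_eq1 _ _ _ _ _ frobG piE) // andbT.
Qed.

Lemma setD1_pi_preim : G :\ 1%g = N^# :|: pi_preim H^#.
Proof.
rewrite -setD_pi_preim; apply/setP=> x; rewrite !inE.
have [Nx | nNx] := boolP (x \in N); first by rewrite (subsetP sNG) //= orbF.
by rewrite andbF /=; case: eqVneq nNx => //= ->; rewrite group1.
Qed.

Variable S : {set gT}.
Hypothesis connS : normal_connection_set G S.
Hypothesis q_ge3 : (3 <= q)%N.
Let T := S :&: H.

Lemma conn_compl_gt0 : (0 < #|T|)%N.
Proof.
have [_ _ ntH _ _] := Frobenius_context frobG.
rewrite lt0n cards_eq0; apply: contraNneq ntH => T0.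
by rewrite -(conn_compl_gen _ _ _ _ _ frobG piE S connS) -/T T0 gen0.
Qed.

Lemma card_conn : #|S| = (#|S :&: N| + #|T| * q)%N.
Proof.
rewrite -sum1_card.
rewrite (conn_sum _ _ _ _ _ _ frobG cardN piE _ connS nat (fun=> 1%N) 1%g
  (group1 G)).
by rewrite sumr_const -[in X in _ + X]mulr_natr !natn.
Qed.

(** The moduli that occur are natural numbers [k], so with [d = #|S|] the bound
    [k <= 2 sqrt (d - 1)] becomes [k ^ 2 + 4 <= 4 d]. The eigenvalue [- e] passes because [d] is at
    least [3]. *)
Lemma ramanujan_of_spectrum (e : bool) :
    S :&: N = (if e then N^# else set0) ->
    (forall mu (F : gT -> algC), (exists2 h, h \in H & F h != 0) ->
      {in H, forall h, \sum_(t in T) F (h * t)%g = mu * F h} ->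
      let a := `|e%:R * (q%:R - 1) + q%:R * mu| in
      a = #|S|%:R \/ exists2 k : nat, a = k%:R & (k ^ 2 + 4 <= 4 * #|S|)%N) ->
  ramanujan_graph (Cay G S).
Proof.
move=> defSN spec; have sSG := conn_sub _ _ _ connS.
have invS := conn_inv _ _ _ connS; have genS := conn_gen _ _ _ connS.
have S_ge3 : (3 <= #|S|)%N.
  rewrite card_conn (leq_trans q_ge3) // (leq_trans _ (leq_addl _ _)) //.
  by rewrite leq_pmull // conn_compl_gt0.
exists #|S|; split; first exact: cay_connected.
  exact: cay_regular.
move=> a /(frob_eigenvalue _ _ _ _ _ _ frobG cardN piE _ connS _ _ defSN) eig_a
  nda.
suff [k -> le_k] : exists2 k : nat, `|a| = k%:R & (k ^ 2 + 4 <= 4 * #|S|)%N.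
  have S_ge1 : (1 <= #|S|)%N by apply: leq_trans S_ge3.
  rewrite -(natrB _ S_ge1) -(@ler_pXn2r _ 2) ?nnegrE ?mulr_ge0 ?sqrtC_ge0 //.
  rewrite exprMn sqrtCK -!natrX -natrM ler_nat; lia.
case: eig_a nda => [-> _ | [mu [F [nzF eigF ->]]] nda].
  by exists e; rewrite ?normrN ?normr_nat //; case: (e); lia.
by have /= [ad | //] := spec mu F nzF eigF; rewrite ad eqxx in nda.
Qed.

Lemma connection_form (e : bool) (A : {set gT}) :
    S = (if e then N^# else set0) :|: pi_preim A -> A \subset H^# ->
  S :&: N = (if e then N^# else set0) /\ T = A.
Proof.
move=> defS sAH; rewrite /T defS !setIUl pi_preim_ker // pi_preim_compl //
  setU0.
have -> : (if e then N^# else set0) :&: H = set0.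
  apply/setP=> x; case: e {defS}; rewrite !inE //; apply/negbTE/negP.
  case/andP=> /andP[ntx Nx] Hx; case/negP: ntx.
  by rewrite -in_set1 -[[set 1%g]]tiNH inE Nx.
by rewrite set0U; case: e {defS}; rewrite ?set0I // (setIidPl (subD1set _ _)).
Qed.

Hypothesis cardH : #|H| = q.-1.

Lemma ramanujan_of_form (e : bool) (A : {set gT}) :
    S = (if e then N^# else set0) :|: pi_preim A -> A \subset H^# ->
    (forall mu (F : gT -> algC), (exists2 h, h \in H & F h != 0) ->
      {in H, forall h, \sum_(t in A) F (h * t)%g = mu * F h} ->
      let a := `|e%:R * (q%:R - 1) + q%:R * mu| in
      a = (e * q.-1 + #|A| * q)%:R \/
      exists2 k : nat, a = k%:R & (k ^ 2 + 4 <= 4 * (e * q.-1 + #|A| * q))%N) ->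
  ramanujan_graph (Cay G S).
Proof.
move=> defS sAH spec; have [defSN defT] := connection_form _ _ defS sAH.
have cardS : #|S| = (e * q.-1 + #|A| * q)%N.
  have cardN1 : #|N^#| = q.-1 by rewrite -cardN [in RHS](cardsD1 1%g N) group1.
  by rewrite card_conn defSN defT; case: (e); rewrite ?cards0 // cardN1 mul1n.
apply: (ramanujan_of_spectrum e) => // mu F nzF eigF.
by rewrite cardS; rewrite -/T defT in eigF; apply: (spec mu F nzF eigF).
Qed.

Let q1 : q%:R - 1 = q.-1%:R :> algC.
Proof. by rewrite -subn1 natrB // (leq_trans _ q_ge3). Qed.

Let cardH1 : #|H^#| = (q - 2)%N.
Proof.
rewrite (_ : (q - 2)%N = q.-1.-1); last by lia.
by rewrite -cardH [in RHS](cardsD1 1%g H) group1.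
Qed.

Lemma ramanujan_complete : S = G :\ 1%g -> ramanujan_graph (Cay G S).
Proof.
rewrite setD1_pi_preim => defS; apply: (ramanujan_of_form true _ defS) => //.
move=> mu F nzF eigF; rewrite !mul1r mul1n q1.
have [-> | ->] := eigenvalue_D1 _ _ _ _ _ nzF eigF erefl; last first.
  by left; rewrite -natrM -natrD normr_nat mulnC.
right; exists 1%N; last by rewrite cardH1; nia.
rewrite -q1 (_ : _ + _ = -1) ?normrN1 //; ring.
Qed.

Lemma ramanujan_multipartite : S = G :\: N -> ramanujan_graph (Cay G S).
Proof.
rewrite setD_pi_preim => defS.
apply: (ramanujan_of_form false H^#) => //; first by rewrite set0U.
move=> mu F nzF eigF; rewrite !mul0r mul0n !add0r add0n normrM normr_nat.
have [-> | ->] := eigenvalue_D1 _ _ _ _ _ nzF eigF erefl; last first.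
  by left; rewrite normr_nat -natrM mulnC.
(* The eigenvalue is [- q]. At [q = 3] the degree [(q - 2) q] is also [3], so this eigenvalue is
   trivial. *)
rewrite normrN1 mulr1 cardH1; have [-> | q_n3] := eqVneq q 3%N; first by left.
by right; exists q => //; nia.
Qed.

Lemma ramanujan_D1z z :
    (5 <= q)%N -> z \in 'Z(H)%g -> #[z]%g = 2%N ->
    S = (N :\ 1%g) :|: pi_preim (H :\: [set 1%g; z]) ->
  ramanujan_graph (Cay G S).
Proof.
move=> q5 Zz oz defS; have Hz : z \in H by apply: (subsetP (center_sub H)).
have ntz : z != 1%g by rewrite -order_gt1 oz.
have cardA : #|H :\: [set 1%g; z]| = (q - 3)%N.
  have := cardsD1 z (H^#); rewrite cardH1 !inE ntz Hz /=.
  rewrite setDDl => e; apply/eqP; rewrite -(eqn_add2l 1) -e; apply/eqP; lia.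
apply: (ramanujan_of_form true _ defS).
  by rewrite setDS // sub1set !inE eqxx.
move=> mu F nzF eigF; rewrite !mul1r mul1n q1.
have [->|->|->] := eigenvalue_D1z _ _ _ _ _ nzF eigF z Hz oz erefl; last first.
- by left; rewrite -natrM -natrD normr_nat mulnC.
(* For [mu = - 2] the eigenvalue is [q - 1 - 2 q = - (q + 1)] and the degree [q ^ 2 - 2 q - 1]; the
   bound reads [3 q ^ 2 - 10 q - 9 >= 0], true from [q = 5] on. *)
- right; exists q.+1; last by rewrite cardA; nia.
  rewrite -q1 (_ : _ + _ = - (q.+1%:R)) ?normrN ?normr_nat //.
  by rewrite -natr1; ring.
- right; exists q.-1; last by rewrite cardA; nia.
  by rewrite mulr0 addr0 normr_nat.
Qed.

Lemma norm_of_sqr (mu : algC) (t : nat) : mu ^+ 2 = t%:R ^+ 2 -> `|mu| = t%:R.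
Proof. by move/eqP; rewrite eqf_sqr => /orP[] /eqP->;
  rewrite ?normrN normr_nat. Qed.

Lemma card_coset2 (K : {group gT}) :
  K \subset H -> #|H : K|%g = 2%N -> (#|H :\: K| * 2)%N = q.-1.
Proof.
move=> sKH iK; rewrite cardsD (setIidPr sKH) -cardH -(Lagrange sKH) iK.
by rewrite -{2}[#|K|]muln1 -mulnBr muln1.
Qed.

Lemma ramanujan_bipartite (K : {group gT}) :
    K \subset H -> #|H : K|%g = 2%N -> S = pi_preim (H :\: K) ->
  ramanujan_graph (Cay G S).
Proof.
move=> sKH iK defS; apply: (ramanujan_of_form false (H :\: K)).
- by rewrite set0U.
- by rewrite setDS // sub1set group1.
move=> mu F nzF eigF; rewrite !mul0r mul0n !add0r add0n normrM normr_nat.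
have [->|/norm_of_sqr ->] := eigenvalue_coset _ _ _ _ _ nzF eigF K sKH iK erefl.
  right; exists 0%N; rewrite ?normr0 ?mulr0 //.
  move: (card_coset2 K sKH iK); move: #|_| => m e;
    have m_gt0 : (0 < m)%N by lia.
  by have := leq_pmull q m_gt0; lia.
by left; rewrite -natrM mulnC.
Qed.

Lemma ramanujan_bipartite_D1 (K : {group gT}) z :
    (7 <= q)%N -> K \subset H -> #|H : K|%g = 2%N ->
    z \in 'Z(H)%g :\: K -> #[z]%g = 2%N -> S = pi_preim ((H :\: K) :\ z) ->
  ramanujan_graph (Cay G S).
Proof.
move=> q7 sKH iK /setDP[Zz nKz] oz defS.
have Hz : z \in H by apply: (subsetP (center_sub H)).
have HKz : z \in H :\: K by rewrite inE nKz.
apply: (ramanujan_of_form false ((H :\: K) :\ z)).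
- by rewrite set0U.
- by rewrite (subset_trans (subD1set _ _)) // setDS // sub1set group1.
move=> mu F nzF eigF; rewrite !mul0r mul0n !add0r add0n normrM normr_nat.
have [mu1|/norm_of_sqr ->] :=
    eigenvalue_coset_D1 _ _ _ _ _ nzF eigF K sKH iK z HKz oz erefl; last first.
  by left; rewrite -natrM mulnC.
(* The modulus is [q] and the degree [q (q - 3) / 2], so the bound reads [q ^ 2 - 6 q - 4 >= 0],
   true from [q = 7] on. *)
right; exists q; first by rewrite (norm_of_sqr mu 1) ?mulr1 // mu1 expr1n.
have cardA : (#|(H :\: K) :\ z|.+1 * 2)%N = q.-1.
  by rewrite -(card_coset2 K sKH iK) (cardsD1 z (H :\: K)) HKz.
by move: cardA; move: #|_| => t; nia.
Qed.

End Forward.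

(** * Numerical inequalities *)

Section Numerics.
Import Order.TTheory GRing.Theory Num.Theory.
Local Open Scope ring_scope.

Lemma int_shift (a x : int) : a <= x -> exists2 v : int, 0 <= v & x = a + v.
Proof. by move=> le; exists (x - a); rewrite ?subr_ge0 // addrC subrK. Qed.

(** The variables [u] and [t] stand for [#|U|] and [#|T|]; the premise comes from [test_delta].
    After [u = v + 4] and [t = w + 1] its left side exceeds the right one by a polynomial with
    positive coefficients. Most inequalities below are treated likewise. *)
Lemma kernel_card_le3 (q u t : int) : 1 <= t -> u + t = q - 2 ->
    (q - 1) * (1 + q ^+ 2 * u) - (1 + q * u) ^+ 2
      <= 4 * (q - 1 + t * q - 1) * (q - 1 - 1) ->
  u <= 3.
Proof.
move=> /int_shift[w w_ge0 ->] eu; rewrite !leNgt => le; apply/negP.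
move=> lt; have /int_shift[v v_ge0 def_v] : 4 <= u by lia.
case/negP: le.
have -> : q = v + w + 7 by lia.
have -> : u = v + 4 by lia.
rewrite -subr_gt0 [ltRHS](_ : _ = 2 * v ^+ 3 + 26 * v ^+ 2 + v ^+ 3 * w
  + 18 * v ^+ 2 * w + 101 * v + 83 * v * w + 2 * v ^+ 2 * w ^+ 2 +
    16 * v * w ^+ 2
  + 73 * w + 8 * w ^+ 2 + v * w ^+ 3 + 101); last by ring.
by rewrite ltr_wpDl // ?addr_ge0 ?mulr_ge0 ?exprn_ge0.
Qed.

(** Since [t = q - 5], only the values [1], [2] and [3] of [t] have to be checked. *)
Lemma kernel_small_triple (q t : int) : 1 <= t -> 3 + t = q - 2 -> q <= 8 ->
    (q - 1) * (1 + q ^+ 2 * 3) - (1 + q * 3) ^+ 2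
      <= 4 * (q - 1 + t * q - 1) * (q - 1 - 1) ->
  False.
Proof.
move=> t1 eu q8; have -> : q = t + 5 by lia.
have [-> // | t1'] := eqVneq t 1.
have [-> // | t2'] := eqVneq t 2.
by have -> : t = 3 by lia.
Qed.

Lemma kernel_large_triple (q t : int) : 9 <= q -> 3 + t = q - 2 ->
    (q - 1) * (3 + 15 * q ^+ 2) - 9 * (1 + 3 * q) ^+ 2
      <= 4 * (q - 1 + t * q - 1) * (3 * (q - 1) - 9) ->
  False.
Proof.
move=> /int_shift[v v_ge0 ->] eu; have -> : t = v + 4 by lia.
apply/negP; rewrite -ltNge -subr_gt0.
rewrite [ltRHS](_ : _ = 3 * v ^+ 3 + 81 * v ^+ 2 + 510 * v + 108); last by ring.
by rewrite ltr_wpDl // ?addr_ge0 ?mulr_ge0 ?exprn_ge0.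
Qed.

Lemma kernel_odd_cycle (q t : int) : 6 <= q -> 2 + t = q - 2 ->
    2 * (1 - q) ^+ 2 + 2 * (3 * q - 2) ^+ 2 + 4 * (q - 1 - 4) * (1 - 2 * q) ^+ 2
      <= 4 * (q - 1 + t * q - 1) * (4 * (q - 1) - 6) ->
  False.
Proof.
move=> /int_shift[v v_ge0 ->] eu; have -> : t = v + 2 by lia.
apply/negP; rewrite -ltNge -subr_gt0.
rewrite [ltRHS](_ : _ = 12 * v ^+ 2 + 112 * v + 150); last by ring.
by rewrite ltr_wpDl // ?addr_ge0 ?mulr_ge0 ?exprn_ge0.
Qed.

Lemma nonbipartite_card_le2 (q u t : int) : 1 <= t -> u + t = q - 2 ->
    q ^+ 2 * ((q - 1) * (1 + u) - (1 + u) ^+ 2) <=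
      4 * (t * q - 1) * (q - 1 - 1) ->
  u <= 2.
Proof.
move=> /int_shift[w w_ge0 ->] eu; rewrite !leNgt => le; apply/negP.
move=> lt; have /int_shift[v v_ge0 def_v] : 3 <= u by lia.
case/negP: le.
have -> : q = v + w + 6 by lia.
have -> : u = v + 3 by lia.
rewrite -subr_gt0 [ltRHS](_ : _ = v ^+ 3 + 12 * v ^+ 2 + v ^+ 3 * w
  + 14 * v ^+ 2 * w + 48 * v + 56 * v * w + 2 * v ^+ 2 * w ^+ 2 +
    13 * v * w ^+ 2
  + 60 * w + 8 * w ^+ 2 + v * w ^+ 3 + 64); last by ring.
by rewrite ltr_wpDl // ?addr_ge0 ?mulr_ge0 ?exprn_ge0.
Qed.

Lemma nonbipartite_pair (q t : int) : 6 <= q -> 2 + t = q - 2 ->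
    q ^+ 2 * (19 * (q - 1) - 81) <= 4 * (t * q - 1) * (3 * (q - 1) - 9) ->
  False.
Proof.
move=> /int_shift[v v_ge0 ->] eu; have -> : t = v + 2 by lia.
apply/negP; rewrite -ltNge -subr_gt0.
rewrite [ltRHS](_ : _ = 7 * v ^+ 3 + 122 * v ^+ 2 + 528 * v + 240);
  last by ring.
by rewrite ltr_wpDl // ?addr_ge0 ?mulr_ge0 ?exprn_ge0.
Qed.

Lemma bipartite_card_le1 (q m t : int) : 1 <= t -> m * 2 = q - 1 ->
    q ^+ 2 * (t * (m - t)) <= 4 * (t * q - 1) * (m - 1) ->
  m - t <= 1.
Proof.
move=> /int_shift[w w_ge0 ->] eq; rewrite !leNgt => le; apply/negP.
move=> lt; have /int_shift[v v_ge0 def_v] : 2 <= m - (1 + w) by lia.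
case/negP: le.
have -> : q = 2 * v + 2 * w + 7 by lia.
have -> : m = v + w + 3 by lia.
rewrite -subr_gt0 [ltRHS](_ : _ = 4 * v ^+ 3 * w + 36 * v ^+ 2 * w + 4 * v ^+ 3
  + 28 * v ^+ 2 + 89 * v * w + 65 * v + 8 * v ^+ 2 * w ^+ 2 + 32 * v * w ^+ 2
  + 58 * w + 12 * w ^+ 2 + 4 * v * w ^+ 3 + 50); last by ring.
by rewrite ltr_wpDl // ?addr_ge0 ?mulr_ge0 ?exprn_ge0.
Qed.

(** If [t = 1] then [q = 5] and the premise reads [25 <= 16]; otherwise [q = 2 t + 3] is at least
    [7]. *)
Lemma bipartite_card_eq1 (q m t : int) : 1 <= t -> m * 2 = q - 1 -> m = t + 1 ->
    q ^+ 2 * (t * (m - t)) <= 4 * (t * q - 1) * (m - 1) ->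
  7 <= q.
Proof.
move=> t1 eq em; have [t1' | t1'] := eqVneq t 1; last by lia.
have -> : q = 5 by lia.
by rewrite em t1'; lia.
Qed.

End Numerics.

(** * Test functions on the complement *)

Section TestFunctions.

Import Order.TTheory GRing.Theory Num.Theory.
Local Open Scope ring_scope.

Variables (gT : finGroupType) (H : {group gT}) (U : {set gT}) (D c C : int).

Local Notation n := #|H|%:Z.
Local Notation u := #|U|%:Z.

(** For inverse-closed [U] this is the adjacency operator of [Cay(H, U)]. *)
Definition conv (f : gT -> int) (h : gT) : int := \sum_(s in U) f (h * s)%g.

(** This is [n] times the squared norm of [f] minus its mean, kept free of denominators. *)
Definition variation (f : gT -> int) : int :=
  n * \sum_(h in H) f h ^+ 2 - (\sum_(h in H) f h) ^+ 2.

Hypothesis sUH : U \subset H.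

Lemma sum_conv f : \sum_(h in H) conv f h = u * \sum_(h in H) f h.
Proof.
rewrite exchange_big (eq_bigr (fun=> \sum_(h in H) f h)) /= => [|s Us].
  by rewrite sumr_const -mulr_natl natz.
rewrite [RHS](reindex_inj (mulIg s)) /=; apply: eq_bigl => h.
by rewrite groupMr // (subsetP sUH).
Qed.

Lemma sum_centered (f : gT -> int) (m : int) :
    m = \sum_(h in H) f h ->
  \sum_(h in H) (n * f h - m) ^+ 2 = n * variation f.
Proof.
move=> def_m; transitivity (\sum_(h in H)
   (n ^+ 2 * f h ^+ 2 - (2 * n * m * f h - m ^+ 2))).
  by apply: eq_bigr => h _; ring.
rewrite sumrB sumrB -!mulr_sumr -def_m sumr_const /variation -def_m -mulr_natl
  natz.
ring.
Qed.

Hypothesis spec : forall f : gT -> int, \sum_(h in H) f h = 0 ->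
  D * \sum_(h in H) (f h + c * conv f h) ^+ 2 <= C * \sum_(h in H) f h ^+ 2.

(** The bound is applied to the centered function [n * f - m]; centering commutes with [conv], which
    multiplies constants by [u]. The parameters serve both cases: [D = 1], [c = q] if [S] contains
    [N^#], and [D = q ^ 2], [c = 1] if [S] misses [N]. *)
Lemma variation_le f :
  D * variation (fun h => f h + c * conv f h) <= C * variation f.
Proof.
have n_gt0 : 0 < n by rewrite ltz_nat cardG_gt0.
set m := \sum_(h in H) f h.
have /spec : \sum_(h in H) (n * f h - m) = 0.
  by rewrite sumrB -mulr_sumr sumr_const -mulr_natl natz subrr.
rewrite sum_centered // => le_f; rewrite -(ler_pM2l n_gt0).
rewrite [leRHS]mulrCA [leLHS]mulrCA; apply: le_trans le_f.
rewrite -(sum_centered _ ((1 + c * u) * m)); last first.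
  by rewrite big_split /= -mulr_sumr sum_conv -/m; ring.
rewrite le_eqVlt; apply/orP; left; apply/eqP; congr (_ * _);
  apply: eq_bigr => h _.
rewrite /conv sumrB -mulr_sumr sumr_const -mulr_natl natz; ring.
Qed.

Lemma sum_indic (A : {set gT}) : A \subset H ->
  \sum_(h in H) (h \in A)%:R = #|A|%:Z.
Proof.
move=> sAH; rewrite -natz -sumr_const [RHS]big_mkcond [LHS]big_mkcond /=.
apply: eq_bigr => h _; have [Ah | _] := boolP (h \in A);
  last by rewrite if_same.
by rewrite (subsetP sAH).
Qed.

Lemma sum_indic_sqr (A : {set gT}) : A \subset H ->
  \sum_(h in H) (h \in A)%:R ^+ 2 = #|A|%:Z.
Proof.
by move=> sAH; rewrite -sum_indic //; apply: eq_bigr => h _; case: (h \in A).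
Qed.

Lemma variation_indic (A : {set gT}) : A \subset H ->
  variation (fun h => (h \in A)%:R) = n * #|A|%:Z - #|A|%:Z ^+ 2.
Proof. by move=> sAH; rewrite /variation sum_indic // sum_indic_sqr. Qed.

(** The indicator of [L] is an eigenfunction of [conv] with eigenvalue [u], and its variation is
    positive because [L] is proper. *)
Lemma test_subgroup (L : {group gT}) :
  U \subset L -> L \proper H -> D * (1 + c * u) ^+ 2 <= C.
Proof.
move=> sUL /properP[sLH [x Hx nLx]].
have ltLH : (#|L| < #|H|)%N by apply/proper_card/properP; split=> //; exists x.
have := variation_le (fun h => (h \in L)%:R).
have -> : variation (fun h => (h \in L)%:R + c * conv (fun h => (h \in L)%:R) h)
    = (1 + c * u) ^+ 2 * variation (fun h => (h \in L)%:R).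
  have e h : (h \in L)%:R + c * conv (fun h => (h \in L)%:R) h =
    (1 + c * u) * (h \in L)%:R.
    rewrite /conv (eq_bigr (fun=> (h \in L)%:R)) => [|s Us]; last first.
      by rewrite groupMr // (subsetP sUL).
    by rewrite sumr_const -mulr_natl natz; ring.
  rewrite /variation (eq_bigr _ (fun h _ => e h)).
  rewrite (eq_bigr (fun h => (1 + c * u) ^+ 2 * (h \in L)%:R ^+ 2)) => [|h _];
    last by rewrite e exprMn.
  by rewrite -!mulr_sumr; ring.
rewrite variation_indic // mulrA ler_pM2r //.
by rewrite expr2 -mulrBl mulr_gt0 ?subr_gt0 ?ltz_nat.
Qed.

(** The sign character with kernel [K] is an eigenfunction of [conv] with eigenvalue [- u]. *)
Lemma test_index2 (K : {group gT}) : (0 < #|U|)%N ->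
  K \subset H -> #|H : K|%g = 2%N -> U \subset H :\: K ->
  D * (1 - c * u) ^+ 2 <= C.
Proof.
move=> U_gt0 sKH iK sUK; pose phi h : int := if h \in K then 1 else -1.
have conv_phi h : h \in H -> conv phi h = - u * phi h.
  move=> Hh; rewrite /conv (eq_bigr (fun=> - phi h)) => [|s Us]; last first.
    by rewrite /phi (index2_mem _ H K) ?(subsetP sUK) //; case: (h \in K).
  by rewrite sumr_const -mulr_natl natz; ring.
(* By [sum_conv] the total [x] satisfies [- u x = u x]. *)
have sum_phi : \sum_(h in H) phi h = 0.
  have := sum_conv phi; rewrite (eq_bigr _ conv_phi) -mulr_sumr => e.
  have /mulfI : u != 0 by rewrite eqz_nat -lt0n.
  by apply; rewrite mulr0; move: e; set x := \sum_(h in H) _; lia.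
have := spec phi sum_phi.
rewrite (eq_bigr (fun=> (1 - c * u) ^+ 2)) => [|h Hh]; last first.
  transitivity (((1 - c * u) * phi h) ^+ 2); first by rewrite conv_phi //; ring.
  by rewrite exprMn /phi; case: ifP => _; rewrite ?sqrrN expr1n mulr1.
rewrite [in leRHS](eq_bigr (fun=> 1)) => [|h Hh]; last first.
  by rewrite /phi; case: ifP => _; rewrite ?sqrrN expr1n.
rewrite !sumr_const -mulr_natl !natz mulrCA [leRHS]mulrC ler_pM2l //.
by rewrite ltz_nat cardG_gt0.
Qed.

Lemma sum_cycle (R : nmodType) (a : gT) (F : gT -> R) :
  \sum_(h in <[a]>%g) F h = \sum_(0 <= i < #[a]%g) F (a ^+ i)%g.
Proof.
pose s := [seq (a ^+ i)%g | i <- iota 0 #[a]%g].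
have uniq_s : uniq s.
  rewrite map_inj_in_uniq ?iota_uniq // => i j; rewrite !mem_iota !add0n /=.
  by move=> lti ltj /eqP; rewrite eq_expg_mod_order !modn_small // => /eqP.
rewrite (eq_bigl (fun h => h \in s)) => [|h].
  by rewrite -big_uniq //= big_map /index_iota subn0.
apply/idP/mapP => [/cyclePmin[i lti ->] | [i _ ->]]; last exact: mem_cycle.
by exists i; rewrite // mem_iota.
Qed.

(* For odd [n] the alternating function on the cycle [Cay(H, {a, a^-1})] cannot
   close up; the test function [1, -2, 2, -2, ..., 2, -2, 1] spreads the defect
   over two neighbouring vertices. *)
Lemma test_odd_cycle (a : gT) : H :=: <[a]>%g -> U = [set a; a^-1%g] ->
  odd #|H| -> (5 <= #|H|)%N ->
  D * (2 * (1 - c) ^+ 2 + 2 * (3 * c - 2) ^+ 2 + 4 * (n - 4) * (1 - 2 * c) ^+ 2)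
    <= C * (4 * n - 6).
Proof.
move=> defH defU odd_n n_ge5.
have oa : #[a]%g = #|H| by rewrite defH.
pose s := [seq (a ^+ i)%g | i <- iota 0 #|H|].
pose g i : int := if (i == 0%N) || (i == #|H|.-1) then 1 else 2 * (-1) ^+ i.
pose f h := g (index h s).
have f_a i : (i < #|H|)%N -> f (a ^+ i)%g = g i.
  move=> lti; rewrite /f -{1}[i]add0n -(nth_iota i 0 lti) -(nth_map _ 1%g)
    ?size_iota //.
  rewrite index_uniq ?size_map ?size_iota // map_inj_in_uniq ?iota_uniq // =>
    j k.
  rewrite !mem_iota !add0n /= -oa => ltj ltk /eqP.
  by rewrite eq_expg_mod_order !modn_small // => /eqP.
have aN : a != a^-1%g.
  apply/eqP=> e; have /eqP : (a ^+ 2 = 1)%g by rewrite expgS expg1 {2}e mulgV.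
  by rewrite -order_dvdn oa => /dvdn_leq => /(_ isT);
    rewrite leqNgt (leq_trans _ n_ge5).
have conv_f h : conv f h = f (h * a)%g + f (h * a^-1)%g.
  by rewrite /conv defU big_setU1 ?inE //= big_set1.
have an1 : (a ^+ #|H|.-1 * a = 1)%g.
  by rewrite -expgSr prednK ?cardG_gt0 // -oa expg_order.
have conv_mid i : (0 < i)%N -> (i < #|H|.-1)%N ->
  conv f (a ^+ i)%g = g i.+1 + g i.-1.
  move=> i_gt0 lti; rewrite conv_f -expgSr f_a; last by lia.
  by rewrite -{2}(prednK i_gt0) expgSr mulgK f_a //; lia.
have conv_0 : conv f (a ^+ 0)%g = g 1%N + g #|H|.-1.
  rewrite conv_f expg0 !mul1g -[X in f X]expg1 f_a; last by lia.
  congr (_ + _); rewrite -(f_a #|H|.-1); last by lia.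
  by congr f; rewrite -[LHS]mul1g -an1 mulgK.
have conv_n : conv f (a ^+ #|H|.-1)%g = g 0%N + g #|H|.-2.
  rewrite conv_f an1 -(expg0 a) f_a; last by lia.
  rewrite -{1}(@prednK #|H|.-1); last by lia.
  by rewrite expgSr mulgK f_a //; lia.
(* Two vertices at each end are treated separately, leaving [m] in the middle; as [m] is odd, the
   inner neighbours of both ends carry [-2]. *)
have [m def_n odd_m] : exists2 m, #|H| = m.+4 & odd m.
  exists (#|H| - 4)%N; first by lia.
  by rewrite oddB ?odd_n // (leq_trans _ n_ge5).
have m_gt0 : (0 < m)%N by case: m odd_m {def_n}.
have sumH (F : gT -> int) : \sum_(h in H) F h =
    F (a ^+ 0)%g + F (a ^+ 1)%g + \sum_(2 <= i < m.+2) F (a ^+ i)%g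
    + F (a ^+ m.+2)%g + F (a ^+ m.+3)%g.
  rewrite defH sum_cycle oa def_n big_ltn // big_ltn //.
  by rewrite big_nat_recr //= big_nat_recr //=; ring.
have gE i : (0 < i < m.+3)%N -> g i = 2 * (-1) ^+ i.
  by rewrite /g def_n /= => lti; rewrite !ifN //; lia.
have g0 : g 0%N = 1 by [].
have g1 : g 1%N = -2 by rewrite gE.
have g2 : g 2%N = 2 by rewrite gE.
have sgn_m : (-1) ^+ m = -1 :> int by rewrite -signr_odd odd_m.
have gm1 : g m.+1 = 2 by rewrite gE ?exprS ?sgn_m //; lia.
have gm2 : g m.+2 = -2 by rewrite gE ?exprS ?sgn_m //; lia.
have gm3 : g m.+3 = 1 by rewrite /g def_n eqxx orbT.
have f0 : f (a ^+ 0)%g = 1 by rewrite f_a ?def_n.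
have f1 : f (a ^+ 1)%g = -2 by rewrite f_a ?def_n.
have fm2 : f (a ^+ m.+2)%g = -2 by rewrite f_a ?def_n.
have fm3 : f (a ^+ m.+3)%g = 1 by rewrite f_a ?def_n.
have c0 : conv f (a ^+ 0)%g = -1 by rewrite conv_0 def_n /= g1 gm3.
have c1 : conv f (a ^+ 1)%g = 3 by rewrite conv_mid ?def_n // g2 g0.
have cm2 : conv f (a ^+ m.+2)%g = 3 by rewrite conv_mid ?def_n //= gm3 gm1.
have cm3 : conv f (a ^+ m.+3)%g = -1 by move: conv_n; rewrite def_n /= g0 gm2.
have fmid i : (2 <= i < m.+2)%N -> f (a ^+ i)%g ^+ 2 = 4.
  move=> lti; rewrite f_a ?def_n; last by lia.
  by rewrite gE ?exprMn ?sqrr_sign //; lia.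
have cmid i : (2 <= i < m.+2)%N -> conv f (a ^+ i)%g = -2 * f (a ^+ i)%g.
  move=> lti; rewrite conv_mid ?def_n; [|lia|lia].
  rewrite f_a ?def_n; last by lia.
  have -> : i = i.-1.+1 by lia.
  by rewrite !gE ?exprS /=; [ring | lia | lia | lia].
(* The middle sum [x] need not be evaluated directly: [sum_conv] reads [4 - 2 x = 2 (x - 2)], so
   [x = 2]. *)
have sum_f : \sum_(h in H) f h = 0.
  have := sum_conv f; rewrite !sumH f0 f1 fm2 fm3 c0 c1 cm2 cm3.
  rewrite (eq_big_nat _ _ cmid) -mulr_sumr defU cards2 aN.
  set x := \sum_(2 <= i < m.+2) _; lia.
have := spec f sum_f; rewrite !sumH f0 f1 fm2 fm3 c0 c1 cm2 cm3 (eq_big_nat _ _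
  fmid).
have psi_mid i : (2 <= i < m.+2)%N ->
    (f (a ^+ i)%g + c * conv f (a ^+ i)%g) ^+ 2 = 4 * (1 - 2 * c) ^+ 2.
  by move=> lti; rewrite cmid // -(fmid i lti); ring.
rewrite (eq_big_nat _ _ psi_mid) !sumr_const_nat !subn2 /= def_n.
rewrite -[4 *+ m]mulr_natl -[_ * _ ^+ 2 *+ m]mulr_natl !natz.
rewrite -[m.+4]addn4 PoszD.
congr (_ * _ <= _ * _); ring.
Qed.

Hypotheses (U1 : 1%g \notin U) (invU : {in U, forall s, s^-1%g \in U}).

Lemma conv_delta h : conv (fun x => (x == 1%g)%:R) h = (h \in U)%:R.
Proof.
rewrite /conv; have [Uh | nUh] := boolP (h \in U).
  rewrite (bigD1 h^-1%g) ?invU //= mulgV eqxx big1 ?addr0 // => s /andP[_].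
  by rewrite -eq_invg_mul eq_sym => /negbTE->.
apply: big1 => s Us; rewrite -eq_invg_mul; case: eqP => // e.
by case/negP: nUh; rewrite -[h]invgK e invU.
Qed.

(** For the delta function [f] at the identity, [f + c * conv f] is [1] at the identity and [c] on
    [U]; these supports are disjoint. *)
Lemma test_delta : D * (n * (1 + c ^+ 2 * u) - (1 + c * u) ^+ 2) <= C * (n - 1).
Proof.
have := variation_le (fun h => (h == 1%g)%:R).
have sum1 : \sum_(h in H) (h == 1%g)%:R = 1 :> int.
  by rewrite (bigD1 1%g) //= eqxx big1 ?addr0 // => h /andP[_ /negbTE->].
have sum2 : \sum_(h in H) (h == 1%g)%:R ^+ 2 = 1 :> int.
  by rewrite -[RHS]sum1; apply: eq_bigr => h _; case: (h == 1%g).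
rewrite {2}/variation sum1 sum2 mulr1 expr1n.
congr (D * _ <= _); rewrite /variation; congr (n * _ - _ ^+ 2).
  transitivity (\sum_(h in H) ((h == 1%g)%:R ^+ 2 +
    c ^+ 2 * (h \in U)%:R ^+ 2) : int).
    apply: eq_bigr => h _; rewrite conv_delta.
    have [-> | _] := eqVneq h 1%g; first by rewrite (negbTE U1) /=; ring.
    by rewrite /=; ring.
  by rewrite big_split /= -mulr_sumr sum2 sum_indic_sqr.
by rewrite big_split /= -mulr_sumr sum_conv sum1 mulr1.
Qed.

Lemma sqr_ge_int (k : int) : k <= k ^+ 2.
Proof. by rewrite -subr_ge0; nia. Qed.

(** Integers satisfy [k <= k ^+ 2], so the surplus of squares over values is at least what the
    points of [A] contribute. *)
Lemma sum_sqr_ge (A : {set gT}) (p : gT -> int) : A \subset H ->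
  \sum_(h in H) p h + \sum_(h in A) (p h ^+ 2 - p h) <= \sum_(h in H) p h ^+ 2.
Proof.
move=> sAH; rewrite -lerBrDl -sumrB [leRHS](big_setID A) /= (setIidPr sAH)
  lerDl.
by apply: sumr_ge0 => h _; rewrite subr_ge0 sqr_ge_int.
Qed.

Lemma conv_ge0 f h : (forall x, 0 <= f x) -> 0 <= conv f h.
Proof. by move=> f_ge0; apply: sumr_ge0. Qed.

Lemma conv_U1 : conv (fun h => (h \in U)%:R) 1%g = u.
Proof.
rewrite /conv (eq_bigr (fun=> 1)) => [|s Us]; last by rewrite mul1g Us.
by rewrite sumr_const natz.
Qed.

(** The test function is the indicator of [U]; cross terms with its convolution are nonnegative and
    dropped. *)
Lemma test_triple : #|U| = 3%N -> 0 <= c -> 0 <= D ->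
  D * (n * (3 + 15 * c ^+ 2) - 9 * (1 + 3 * c) ^+ 2) <= C * (3 * n - 9).
Proof.
move=> U3 c_ge0 D_ge0; pose phi h : int := (h \in U)%:R.
have := variation_le phi; rewrite variation_indic // U3.
rewrite (_ : n * 3%:Z - 3%:Z ^+ 2 = 3 * n - 9); last by ring.
apply: le_trans; rewrite ler_wpM2l //.
have sum_phi : \sum_(h in H) phi h = 3 by rewrite sum_indic // U3.
have sum_cphi : \sum_(h in H) conv phi h = 9 by rewrite sum_conv sum_phi U3.
rewrite /variation big_split /= -mulr_sumr sum_phi sum_cphi.
(* The total is [9] and the value at the identity is [3], whence [9 + (9 - 3) = 15]. *)
have le15 : 15 <= \sum_(h in H) conv phi h ^+ 2.
  have := sum_sqr_ge [set 1%g] (conv phi); rewrite sub1set group1 big_set1.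
  by rewrite conv_U1 U3 sum_cphi => /(_ isT).
rewrite (_ : 9 * (1 + 3 * c) ^+ 2 = (3 + c * 9) ^+ 2); last by ring.
rewrite lerD2r ler_wpM2l //.
apply: (@le_trans _ _ (\sum_(h in H) (phi h ^+ 2 + c ^+ 2 * conv phi h ^+ 2))).
  rewrite big_split /= -mulr_sumr sum_indic_sqr // U3 lerD2l mulrC.
  by rewrite ler_wpM2l // sqr_ge0.
apply: ler_sum => h _; have : 0 <= phi h * (c * conv phi h).
  by rewrite mulr_ge0 ?mulr_ge0 ?conv_ge0 // /phi => *; case: (_ \in _).
nia.
Qed.

(** The test function is the indicator of [1] together with [U]. Its image [psi] has total [9] and
    values at least [3], [2], [2] on that set, whence [9 + 6 + 2 + 2 = 19]. *)
Lemma test_pair a b : c = 1 -> 0 <= D -> a != b -> U = [set a; b] ->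
  D * (19 * n - 81) <= C * (3 * n - 9).
Proof.
move=> c1 D_ge0 neq_ab defU.
pose L := 1%g |: U; pose phi h : int := (h \in L)%:R.
have sLH : L \subset H by rewrite subUset sub1set group1.
have U2 : #|U| = 2%N by rewrite defU cards2 neq_ab.
have L3 : #|L| = 3%N by rewrite /L cardsU1 U1 U2.
have := variation_le phi; rewrite variation_indic // L3 c1.
rewrite (_ : n * 3%:Z - 3%:Z ^+ 2 = 3 * n - 9); last by ring.
apply: le_trans; rewrite ler_wpM2l //.
have sum_phi : \sum_(h in H) phi h = 3 by rewrite sum_indic // L3.
pose psi h := phi h + 1 * conv phi h.
have sum_psi : \sum_(h in H) psi h = 9.
  by rewrite big_split /= -mulr_sumr sum_conv sum_phi U2.
rewrite /variation -/psi sum_psi lerD2r mulrC ler_wpM2l //.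
have psi1 : 3 <= psi 1%g.
  rewrite /psi /conv (eq_bigr (fun=> 1)) => [|s Us];
    last by rewrite mul1g /phi !inE Us orbT.
  by rewrite sumr_const U2 /phi !inE eqxx.
have psiU x : x \in U -> 2 <= psi x.
  move=> Ux; have Lx : x \in L by rewrite !inE Ux orbT.
  rewrite /psi mul1r /phi Lx /conv (bigD1 x^-1%g) ?invU //= mulgV setU11.
  by rewrite -[2]/(1 + 1) lerD2l lerDl sumr_ge0.
have := sum_sqr_ge L psi sLH; rewrite sum_psi => leL; apply: le_trans leL.
rewrite (_ : 19 = 9 + 10) // lerD2l big_setU1 // defU big_setU1 ?inE //=
  big_set1.
have pa : 2 <= psi a by rewrite psiU // defU !inE eqxx.
have pb : 2 <= psi b by rewrite psiU // defU !inE eqxx orbT.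
move: psi1 pa pb; move: (psi 1%g) (psi a) (psi b) => x y z; nia.
Qed.

End TestFunctions.

Arguments conv {gT}.

(** * Ramanujan connection sets *)

Lemma invariant_singleton (gT : finGroupType) (H : {group gT}) (z : gT) :
    z \in H -> z != 1 -> (forall g, g \in H -> z ^ g = z) -> z^-1 = z ->
  z \in 'Z(H) /\ #[z] = 2.
Proof.
move=> Hz ntz fixz invz; split; last first.
  by apply: nt_prime_order => //; rewrite expgS expg1 -{2}invz mulgV.
apply/centerP; split=> // g Hg.
by apply/commgP/conjg_fixP/fixz.
Qed.

Section Backward.

Import Order.TTheory GRing.Theory Num.Theory.
Local Open Scope ring_scope.

Variables (gT : finGroupType) (G N H : {group gT}) (q : nat) (pi : gT -> gT).
Hypotheses (frobG : [Frobenius G = N ><| H]) (q_ge3 : (3 <= q)%N).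
Hypotheses (cardN : #|N| = q) (cardH : #|H| = q.-1).
Hypothesis piE : {in N & H, forall n h, pi (n * h)%g = h}.
Variable S : {set gT}.
Hypothesis connS : normal_connection_set G S.
Hypothesis ramS : ramanujan_graph (Cay G S).

Let T := S :&: H.
Let U := H^# :\: T.
Let sNG : N \subset G.
Proof. by have [/sdprod_context[/andP[]]] := Frobenius_context frobG. Qed.
Let sHG : H \subset G.
Proof. by have [/sdprod_context[]] := Frobenius_context frobG. Qed.
Let sSG := conn_sub _ _ _ connS.
Let genS := conn_gen _ _ _ connS.
Let sTH1 : T \subset H^# := conn_compl_sub _ _ _ _ connS.
Let sTH : T \subset H := subsetIr S H.
Let genT : <<T>>%g = H := conn_compl_gen _ _ _ _ _ frobG piE _ connS.
Let T_gt0 : (0 < #|T|)%N := conn_compl_gt0 _ _ _ _ _ frobG piE _ connS.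
Let cardS : #|S| = (#|S :&: N| + #|T| * q)%N :=
  card_conn _ _ _ _ _ _ frobG cardN piE _ connS.
Let S_gt0 : (0 < #|S|)%N.
Proof.
by rewrite cardS addn_gt0 muln_gt0 T_gt0 (leq_trans _ q_ge3) ?orbT.
Qed.
Let q_gt0 : 0 < q%:Z. Proof. by rewrite ltz_nat (leq_trans _ q_ge3). Qed.
Let nE : #|H|%:Z = q%:Z - 1. Proof. by rewrite cardH; lia. Qed.

Let invT : {in T, forall s, s^-1%g \in T}.
Proof.
by move=> s /setIP[Ss Hs]; rewrite inE groupV Hs (conn_inv _ _ _ connS).
Qed.

Let sUH : U \subset H.
Proof. by apply: subset_trans (subsetDl _ _) (subsetDl _ _). Qed.

Let U1 : 1%g \notin U.
Proof. by rewrite !inE eqxx /= andbF. Qed.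

Let invU : {in U, forall s, s^-1%g \in U}.
Proof.
move=> s /setDP[Hs nTs]; rewrite inE; apply/andP; split.
  by apply: contra nTs => /invT; rewrite invgK.
by move: Hs; rewrite !inE groupV invg_eq1.
Qed.

Let conjU s g : s \in U -> g \in H -> (s ^ g)%g \in U.
Proof.
move=> /setDP[/setD1P[nt Hs] nTs] Hg;
  rewrite !inE conjg_eq1 nt groupJ //= !andbT.
apply: contra nTs => SJ; rewrite inE Hs andbT -(conjgK g s).
by rewrite (conn_conj _ _ _ connS) // groupV (subsetP sHG).
Qed.

Let card_UT : #|U|%:Z + #|T|%:Z = q%:Z - 2.
Proof.
have : (#|U| + #|T|).+1 = #|H|.
  rewrite (cardsD1 1%g H) group1 -(cardsID T H^#) (setIidPr sTH1) addnC.
  by rewrite add1n.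
by rewrite cardH; lia.
Qed.

(** The group [H] splits into [1], [T] and [U]; this trades [T] for its complement, which will turn
    out small. *)
Let conv_compl f h : \sum_(x in H) f x = 0 -> h \in H ->
  conv T f h = - (f h + conv U f h).
Proof.
move=> sum_f Hh; have := sum_mulgD1 _ H _ f h Hh.
rewrite sum_f (big_setID T) /= (setIidPr sTH1) => e.
by apply/eqP; rewrite -addr_eq0 /conv addrCA e; apply/eqP; ring.
Qed.

Lemma sum_pi_int (F : gT -> int) :
  \sum_(x in G) F (pi x) = q%:Z * \sum_(h in H) F h.
Proof.
transitivity (\sum_(x in G | predT (pi x)) F (pi x)).
  by apply: eq_bigl => x; rewrite andbT.
rewrite (sum_pi _ _ _ _ _ _ frobG cardN piE _ predT) -mulr_natl natz.
by congr (_ * _); apply: eq_bigl => h; rewrite andbT.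
Qed.

Lemma ramanujan_compl_test (f : gT -> int) :
    \sum_(h in H) f h = 0 ->
    (forall w : gT -> algC, {in G & S, forall y s, w (y * s)%g = - w y} ->
       \sum_(x in G) (f (pi x))%:~R * w x = 0) ->
  \sum_(h in H) (f h * #|S :&: N|%:Z + q%:Z * conv T f h) ^+ 2
    <= 4 * (#|S|%:Z - 1) * \sum_(h in H) f h ^+ 2.
Proof.
move=> sum_f alt_f.
have := ramanujan_test _ G S sSG (conn_inv _ _ _ connS) genS (fun x =>
  f (pi x)) ramS S_gt0.
rewrite sum_pi_int sum_f mulr0 (sum_pi_int (fun h => f h ^+ 2)) =>
  /(_ erefl alt_f).
rewrite (eq_bigr (fun x => (f (pi x) * #|S :&: N|%:Z +
  q%:Z * conv T f (pi x)) ^+ 2)).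
  rewrite (sum_pi_int (fun h => (f h * #|S :&: N|%:Z +
    q%:Z * conv T f h) ^+ 2)).
  by rewrite mulrCA ler_pM2l.
move=> x Gx; rewrite (conn_sum _ _ _ _ _ _ frobG cardN piE _ connS) //.
by rewrite -mulr_natr -[_ *+ q]mulr_natl !natz.
Qed.

Lemma alternating_eq0 (w : gT -> algC) :
  w 1%g = 0 -> {in G & S, forall y s, w (y * s)%g = - w y} ->
  {in G, forall x, w x = 0}.
Proof.
move=> w1 alt_w; apply: (gen_mulr_ind _ G S sSG genS) => // y s Gy Ss wy.
by rewrite alt_w // wy oppr0.
Qed.

(** * Connection sets containing the nontrivial kernel elements *)

Section KernelIncluded.

Hypothesis SN : S :&: N = N^#.

Let cardSN : #|S :&: N|%:Z = q%:Z - 1.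
Proof.
have -> : #|S :&: N| = q.-1 by rewrite SN -cardN [in RHS](cardsD1 1%g N) group1.
by lia.
Qed.

(** As [N] has at least three elements, some [n], [m] and [n * m] all lie in [N^#]. They span a
    triangle in the graph, which forces [w 1 = - w 1]. *)
Lemma alternating_kernel0 (w : gT -> algC) :
  {in G & S, forall y s, w (y * s)%g = - w y} -> w 1%g = 0.
Proof.
move=> alt_w; have /card_gt0P[n Nn] : (0 < #|N^#|)%N by rewrite -SN -ltz_nat
  cardSN; lia.
have /card_gt0P[m] : (0 < #|N^# :\ n^-1%g|)%N.
  rewrite lt0n; apply/eqP=> k0; have := cardSN.
  by rewrite SN (cardsD1 n^-1%g N^#) k0; case: (_ \in N^#); move: q_ge3; clear;
    lia.
move=> /setD1P[neq Nm]; have sN x : x \in N^# ->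
  x \in S by rewrite -SN => /setIP[].
have Nnm : (n * m)%g \in N^#.
  move: Nn Nm; rewrite !inE => /andP[_ Nn] /andP[_ Nm]; rewrite groupM // andbT.
  by rewrite -eq_invg_mul eq_sym.
have Gn : n \in G by apply: (subsetP sNG); case/setD1P: Nn.
have := alt_w 1%g (n * m)%g (group1 G) (sN _ Nnm).
rewrite mul1g alt_w ?sN // -{1}[n]mul1g alt_w ?sN // opprK => /eqP.
by rewrite -addr_eq0 -mulr2n mulrn_eq0 => /eqP.
Qed.

Lemma kernel_test (f : gT -> int) : \sum_(h in H) f h = 0 ->
  1 * \sum_(h in H) (f h + q%:Z * conv U f h) ^+ 2
    <= 4 * (q%:Z - 1 + #|T|%:Z * q%:Z - 1) * \sum_(h in H) f h ^+ 2.
Proof.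
move=> sum_f; rewrite mul1r.
have -> : \sum_(h in H) (f h + q%:Z * conv U f h) ^+ 2 =
    \sum_(h in H) (f h * #|S :&: N|%:Z + q%:Z * conv T f h) ^+ 2.
  by apply: eq_bigr => h Hh; rewrite conv_compl // cardSN; ring.
rewrite -cardSN -PoszM -PoszD -cardS; apply: ramanujan_compl_test => // w alt_w.
apply: big1 => x Gx.
by rewrite (alternating_eq0 w (alternating_kernel0 w alt_w)) ?mulr0.
Qed.

(** The pair must generate [H]. If [a] and [b] are involutions, they commute and [H] has at most
    four elements; otherwise [b = a^-1] and [H] is a cycle, excluded according to its parity. *)
Lemma kernel_no_pair a b : a != b -> U = [set a; b] -> False.
Proof.
move=> neq_ab defU; have U2 : #|U| = 2%N by rewrite defU cards2 neq_ab.
have eT : #|T|%:Z = q%:Z - 4 by have := card_UT; rewrite U2; lia.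
have q_ge5 : (5 <= q)%N by have : 0 < #|T|%:Z by []; lia.
have Ua : a \in U by rewrite defU !inE eqxx.
have Ub : b \in U by rewrite defU !inE eqxx orbT.
(* With [#|T| = q - 4] the right side is [4 q ^ 2 - 12 q - 8], less than [(2 q - 1) ^ 2]. *)
have neg_big (x : int) : x ^+ 2 = (1 + q%:Z * 2) ^+ 2 \/ x ^+ 2 =
  (1 - q%:Z * 2) ^+ 2 ->
    1 * x ^+ 2 <= 4 * (q%:Z - 1 + #|T|%:Z * q%:Z - 1) -> False.
  by rewrite eT => -[] ->; move: q_ge5; clear; nia.
have genU : <<U>>%g = H.
  apply/eqP; apply/negPn/negP => neq.
  apply: (neg_big (1 + q%:Z * #|U|%:Z)); first by left; rewrite U2.
  apply: (test_subgroup _ _ _ _ _ _ sUH kernel_test <<U>>%G);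
    first exact: subset_gen.
  by rewrite properEneq neq gen_subG.
have no_index2 (K : {group gT}) : K \subset H -> #|H : K|%g = 2%N ->
  U \subset H :\: K -> False.
  move=> sKH iK sUK; apply: (neg_big (1 - q%:Z * #|U|%:Z)); first by right;
    rewrite U2.
  by apply: (test_index2 _ _ _ _ _ _ sUH kernel_test K) => //; rewrite U2.
have := invU a Ua; rewrite {1}defU !inE => /orP[] /eqP aV.
  have bV : b^-1%g = b.
    have := invU b Ub; rewrite {1}defU !inE => /orP[] /eqP // bVa.
    by case/eqP: neq_ab; rewrite -aV -bVa invgK.
  have cab : commute a b.
    have := conjU a b Ua (subsetP sUH b Ub);
      rewrite {1}defU !inE => /orP[] /eqP ab.
      by apply/commgP/conjg_fixP.
    by case/eqP: neq_ab; apply: (conjg_inj b); rewrite ab conjgE mulKg.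
  have order2 x : x \in U -> x^-1%g = x -> #[x]%g = 2%N.
    move=> Ux xV; apply: nt_prime_order => //;
      first by rewrite expgS expg1 -{2}xV mulgV.
    by apply: contraTneq Ux => ->.
  have le4 : (#|H| <= 4)%N.
    have sH : H \subset (<[a]> * <[b]>)%g.
      rewrite -cent_joinEr ?cycle_abelian //;
        last by rewrite cent_cycle cycle_subG; apply/cent1P.
      by rewrite -genU gen_subG defU subUset !sub1set !mem_gen // inE cycle_id
        ?orbT.
    apply: leq_trans (subset_leq_card sH) _.
    have := mul_cardG <[a]>%G <[b]>%G; rewrite /= -!orderE !order2 // => e.
    by rewrite -[4%N]/(2 * 2)%N e leq_pmulr // (cardG_gt0 (<[a]> :&: <[b]>)%G).
  (* Now [#|H| = 4], and the only element of [T] is its own inverse, so it cannot generate [H]. *)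
  have /eqP/cards1P[x defT] : #|T| = 1%N.
    by move: le4 eT q_ge5; rewrite cardH; clear; lia.
  have Tx : x \in T by rewrite defT inE.
  have xV : x^-1%g = x by have := invT x Tx; rewrite defT inE => /eqP.
  have : #[x]%g = #|H| by rewrite -genT defT.
  have : (#[x]%g <= 2)%N.
    by apply/dvdn_leq => //; rewrite order_dvdn expgS expg1 -{2}xV mulgV.
  by move: le4 q_ge5; rewrite cardH; clear; lia.
have defH : H :=: <[a]>%g.
  apply/eqP; rewrite eqEsubset cycle_subG (subsetP sUH) // -genU gen_subG andbT.
  by rewrite defU subUset !sub1set cycle_id -aV groupV cycle_id.
have [odd_n | even_n] := boolP (odd #|H|).
  apply: (kernel_odd_cycle q%:Z #|T|%:Z).
  - by move: odd_n q_ge5; rewrite cardH; clear; lia.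
  - by rewrite eT; clear; lia.
  have := test_odd_cycle _ _ _ _ _ _ sUH kernel_test a defH.
  by rewrite nE mul1r; apply=> //; [rewrite aV | move: odd_n q_ge5;
    rewrite cardH; clear; lia].
have oa : #[a]%g = #|H| by rewrite defH.
have dvd2 : (2 %| #[a]%g)%N by rewrite dvdn2 oa.
(* In an even cycle the squares form a subgroup of index two missing [a] and [a^-1], so the sign
   character applies. *)
have nKa : a \notin <[a ^+ 2]>%g.
  apply/negP; rewrite -cycle_subG => /subset_leq_card.
  rewrite -!orderE (orderXdiv dvd2) leqNgt ltn_Pdiv //.
have sKH : <[a ^+ 2]>%g \subset H by rewrite cycle_subG groupX ?(subsetP sUH).
apply: (no_index2 <[a ^+ 2]>%G) => //.
  rewrite -divgS //= -orderE (orderXdiv dvd2) -oa divnA // mulKn //.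
by rewrite defU -aV subUset !sub1set !inE !groupV nKa (subsetP sUH).
Qed.

(** The delta function leaves [#|U| <= 3]. A singleton [U] is invariant under conjugation and
    inversion, which makes its element a central involution; pairs and triples are excluded. *)
Lemma kernel_cases :
  U = set0 \/ exists2 z, (5 <= q)%N /\ U = [set z] & z \in 'Z(H)%g /\ #[z]%g =
    2%N.
Proof.
have T_ge1 : 1 <= #|T|%:Z by [].
have delta : (q%:Z - 1) * (1 + q%:Z ^+ 2 * #|U|%:Z) - (1 + q%:Z * #|U|%:Z) ^+ 2
    <= 4 * (q%:Z - 1 + #|T|%:Z * q%:Z - 1) * (q%:Z - 1 - 1).
  by have := test_delta _ _ _ _ _ _ sUH kernel_test U1 invU; rewrite nE mul1r.
have := kernel_card_le3 _ _ _ T_ge1 card_UT delta.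
case: (posnP #|U|) => [/eqP | U_gt0 U_le3]; first by rewrite cards_eq0 => /eqP;
  left.
have : [\/ #|U| = 1%N, #|U| = 2%N | #|U| = 3%N].
  move: U_gt0 U_le3; case: #|U| => [|[|[|[|k]]]] // _ _;
    by [constructor 1|constructor 2|constructor 3].
case=> [/eqP/cards1P[z defU] | /eqP/cards2P[a [b [neq defU]]] | U3].
- have Uz : z \in U by rewrite defU inE.
  have Hz := subsetP sUH z Uz.
  have [Zz oz] : z \in 'Z(H)%g /\ #[z]%g = 2%N.
    apply: invariant_singleton => // [|g Hg|];
      first by apply: contraTneq Uz => ->.
      by have := conjU z g Uz Hg; rewrite defU => /set1P.
    by have := invU z Uz; rewrite defU => /set1P.
  right; exists z => //; split=> //.
  (* As [q - 1] is even and [#|T| = q - 3] is positive, [q] is odd and at least [5]. *)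
  have : (2 %| #|H|)%N by rewrite -oz order_dvdG.
  by have := card_UT; move: T_gt0; rewrite defU cards1 cardH; clear; lia.
- by case: (kernel_no_pair _ _ neq defU).
have eT : 3 + #|T|%:Z = q%:Z - 2 by rewrite -card_UT U3.
case: (leqP q 8) => q8.
  by rewrite U3 in delta; case: (kernel_small_triple _ _ T_ge1 eT _ delta).
case: (kernel_large_triple q%:Z #|T|%:Z) => //.
have := test_triple _ _ _ _ _ _ sUH kernel_test U1 U3.
by rewrite nE mul1r; apply.
Qed.

End KernelIncluded.

(** * Connection sets disjoint from the kernel *)

Section KernelExcluded.

Hypothesis SN : S :&: N = set0.

Let cardS0 : #|S| = (#|T| * q)%N.
Proof. by rewrite cardS SN cards0. Qed.

Let excluded_ramanujan (f : gT -> int) :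
    \sum_(h in H) f h = 0 ->
    (forall w : gT -> algC, {in G & S, forall y s, w (y * s)%g = - w y} ->
       \sum_(x in G) (f (pi x))%:~R * w x = 0) ->
  q%:Z ^+ 2 * \sum_(h in H) conv T f h ^+ 2
    <= 4 * (#|T|%:Z * q%:Z - 1) * \sum_(h in H) f h ^+ 2.
Proof.
move=> sum_f alt_f; have := ramanujan_compl_test f sum_f alt_f.
rewrite cardS0 PoszM SN cards0; apply: le_trans.
rewrite mulr_sumr le_eqVlt; apply/orP; left; apply/eqP.
by apply: eq_bigr => h _; rewrite mulr0 add0r exprMn.
Qed.

(** An alternating function nonzero at [1] would restrict to one on [H], giving a subgroup of index
    two disjoint from [T]. *)
Lemma excluded_test (f : gT -> int) :
    (forall K : {group gT}, K <| H -> #|H : K|%g = 2%N ->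
      ~~ (T \subset H :\: K)) ->
    \sum_(h in H) f h = 0 ->
  q%:Z ^+ 2 * \sum_(h in H) (f h + 1 * conv U f h) ^+ 2
    <= 4 * (#|T|%:Z * q%:Z - 1) * \sum_(h in H) f h ^+ 2.
Proof.
move=> no_bip sum_f.
have -> : \sum_(h in H) (f h + 1 * conv U f h) ^+ 2 =
  \sum_(h in H) conv T f h ^+ 2.
  by apply: eq_bigr => h Hh; rewrite conv_compl // sqrrN mul1r.
apply: excluded_ramanujan => // w alt_w; apply: big1 => x Gx.
rewrite alternating_eq0 ?mulr0 //; apply/eqP/negPn/negP => nz_w1.
have [K [nKH iK sTK]] : exists K : {group gT},
    [/\ K <| H, #|H : K|%g = 2%N & T \subset H :\: K].
  apply: (alternating_index2 _ _ _ sTH genT w) => // y s Hy /setIP[Ss _].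
  by rewrite alt_w // (subsetP sHG).
by case/negP: (no_bip K nKH iK).
Qed.

(** The delta function leaves [#|U| <= 2]. A singleton generates a proper subgroup, against
    [test_subgroup]; a pair violates [test_pair] for [q >= 6] and the delta bound for [q = 5]. *)
Lemma nonbipartite_case :
    (forall K : {group gT}, K <| H -> #|H : K|%g = 2%N ->
      ~~ (T \subset H :\: K)) ->
  U = set0.
Proof.
move=> no_bip; have test f := excluded_test f no_bip.
have T_ge1 : 1 <= #|T|%:Z by [].
have delta : q%:Z ^+ 2 * ((q%:Z - 1) * (1 + #|U|%:Z) - (1 + #|U|%:Z) ^+ 2)
    <= 4 * (#|T|%:Z * q%:Z - 1) * (q%:Z - 1 - 1).
  by have := test_delta _ _ _ _ _ _ sUH test U1 invU; rewrite nE expr1n !mul1r.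
have := nonbipartite_card_le2 _ _ _ T_ge1 card_UT delta.
case: (posnP #|U|) => [/eqP | U_gt0 U_le2]; first by rewrite cards_eq0 => /eqP.
have : #|U| = 1%N \/ #|U| = 2%N.
  by move: U_gt0 U_le2; case: #|U| => [|[|[|k]]] // _ _; [left | right].
case=> [/eqP/cards1P[z defU] | /eqP/cards2P[a [b [neq defU]]]].
  have Uz : z \in U by rewrite defU inE.
  have Hz := subsetP sUH z Uz.
  have zV : z^-1%g = z by have := invU z Uz; rewrite defU => /set1P.
  have ltz : <[z]>%g \proper H.
    have eT : #|T|%:Z = q%:Z - 3 by have := card_UT; rewrite defU cards1;
      clear; lia.
    rewrite properEcard cycle_subG Hz -orderE.
    apply: (@leq_ltn_trans 2%N).
      by apply/dvdn_leq => //; rewrite order_dvdn expgS expg1 -{2}zV mulgV.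
    by move: eT T_gt0; rewrite cardH; clear; lia.
  have sUz : U \subset <[z]>%g by rewrite defU sub1set cycle_id.
  have := test_subgroup _ _ _ _ _ _ sUH test <[z]>%G sUz ltz.
  have -> : #|T|%:Z = q%:Z - 3 by have := card_UT; rewrite defU cards1; clear;
    lia.
  rewrite defU cards1; move: q_ge3; clear; nia.
have U2 : #|U| = 2%N by rewrite defU cards2 neq.
have eT : 2 + #|T|%:Z = q%:Z - 2 by rewrite -card_UT U2.
case: (leqP 6 q) => q6.
  case: (nonbipartite_pair q%:Z #|T|%:Z) => //.
  by have := test_pair _ _ _ _ _ _ sUH test U1 invU a b erefl; rewrite nE;
    apply=> //; apply: sqr_ge0.
have q5 : q = 5%N by move: q6 T_gt0 eT; clear; lia.
have t1 : #|T| = 1%N by move: q5 eT; clear; lia.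
by move: delta; rewrite U2 q5 t1.
Qed.

(** The test function is [m = #|K|] times the delta at [1], minus the indicator of [K]. It has sum
    zero and is supported on [K], so it is orthogonal to constants and to alternating functions
    alike. *)
Lemma bipartite_case (K : {group gT}) : K <| H -> #|H : K|%g = 2%N ->
  T \subset H :\: K ->
  T = H :\: K \/ exists2 z, (7 <= q)%N /\ T = (H :\: K) :\ z
    & z \in 'Z(H)%g :\: K /\ #[z]%g = 2%N.
Proof.
move=> nKH iK sTK; have sKH := normal_sub nKH.
have card_K : (#|H :\: K| * 2)%N = q.-1 := card_coset2 _ _ _ cardH K sKH iK.
have card_K' : #|K| = #|H :\: K|.
  have := cardsID K H; rewrite (setIidPr sKH) cardH; move: card_K; clear; lia.
have T_ge1 : 1 <= #|T|%:Z by [].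
pose m := #|K|%:Z; pose f h : int := m * (h == 1%g)%:R - (h \in K)%:R.
have m2 : m * 2 = q%:Z - 1 by rewrite /m card_K'; move: card_K q_ge3; clear;
  lia.
have sum1 : \sum_(h in H) (h == 1%g)%:R = 1 :> int.
  by rewrite (bigD1 1%g) //= eqxx big1 ?addr0 // => h /andP[_ /negbTE->].
have sum_f : \sum_(h in H) f h = 0.
  by rewrite sumrB -mulr_sumr sum1 sum_indic // mulr1 subrr.
have alt_f (w : gT -> algC) : {in G & S, forall y s, w (y * s)%g = - w y} ->
    \sum_(x in G) (f (pi x))%:~R * w x = 0.
  move=> alt_w.
  (* Each step along [S] moves [pi x] to the other coset of [K], so [w] is a multiple of the sign
     character. *)
  have w_sign : {in G, forall x, w x = (-1) ^+ (pi x \notin K) * w 1%g}.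
    apply: (gen_mulr_ind _ G S sSG genS) => [|y s Gy Ss IHy].
      by rewrite (pi_ker _ _ _ _ piE 1%g (group1 N)) group1 mul1r.
    have Gs := subsetP sSG s Ss.
    have Ts : pi s \in T.
      have pis : pi s != 1%g.
        rewrite (pi_eq1 _ _ _ _ _ frobG piE) //; apply/negP => Ns.
        by have := in_set0 s; rewrite -SN inE Ss Ns.
      rewrite inE (pi_in _ _ _ _ _ frobG piE) // andbT.
      by rewrite -(conn_coset _ _ _ _ _ frobG piE _ connS).
    rewrite alt_w // IHy (piM _ _ _ _ _ frobG piE) //.
    rewrite (index2_mem _ H K) ?(subsetP sTK) ?(pi_in _ _ _ _ _ frobG piE) //.
    by case: (pi y \in K); rewrite /= ?expr0 ?expr1; ring.
  rewrite (eq_bigr (fun x => (f (pi x))%:~R * w 1%g)) => [|x Gx]; last first.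
    rewrite w_sign //; have [Kx | nKx] := boolP (pi x \in K);
      first by rewrite mul1r.
    rewrite /f (negbTE nKx) (_ : (pi x == 1%g) = false) ?mulr0 ?mul0r //.
    by apply: contraNF nKx => /eqP->.
  by rewrite -mulr_suml -rmorph_sum /= sum_pi_int sum_f mulr0 mul0r.
(* The convolution is [m - #|T|] on [T], [- #|T|] on the rest of [H :\: K], and zero on [K]. *)
have convf h : h \in H -> conv T f h ^+ 2 =
    (m - #|T|%:Z) ^+ 2 * (h \in T)%:R +
      #|T|%:Z ^+ 2 * (h \in (H :\: K) :\: T)%:R.
  move=> Hh; have -> : conv T f h =
    m * (h \in T)%:R - #|T|%:Z * (h \notin K)%:R.
    rewrite /conv sumrB -mulr_sumr -(conv_delta _ T invT); congr (_ - _).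
    rewrite (eq_bigr (fun=> (h \notin K)%:R)) => [|t Tt]; last first.
      by rewrite (index2_mem _ H K) // (subsetP sTK).
    by rewrite sumr_const -[_ *+ #|T|]mulr_natl natz.
  have [Th | nTh] := boolP (h \in T).
    have /setDP[_ nKh] := subsetP sTK h Th.
    by rewrite in_setD Th (negbTE nKh) /=; ring.
  by rewrite in_setD nTh in_setD Hh; case: (h \in K) => /=; ring.
have := excluded_ramanujan f sum_f alt_f.
rewrite (eq_bigr _ convf) big_split /= -!mulr_sumr !sum_indic //; last first.
  by rewrite (subset_trans (subsetDl _ _)) ?subsetDl.
have -> : \sum_(h in H) f h ^+ 2 = m * (m - 1).
  transitivity (\sum_(h in H) ((m ^+ 2 - 2 * m) * (h == 1%g)%:R +
    (h \in K)%:R)).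
    apply: eq_bigr => h _; rewrite /f; have [-> | _] := eqVneq h 1%g.
      by rewrite group1 /=; ring.
    by case: (h \in K) => /=; ring.
  by rewrite big_split /= -mulr_sumr sum1 sum_indic //; rewrite -/m; ring.
have le_tm : (#|T| <= #|H :\: K|)%N by apply: subset_leq_card.
rewrite cardsDS // -subzn // -card_K' -/m => le_m.
have m_gt0 : 0 < m by rewrite ltz_nat cardG_gt0.
(* With [t = #|T|], the identity [t (m - t) ^ 2 + t ^ 2 (m - t) = m t (m - t)] exhibits the factor
   [m], which cancels. *)
have {}le_m : q%:Z ^+ 2 * (#|T|%:Z * (m - #|T|%:Z)) <=
  4 * (#|T|%:Z * q%:Z - 1) * (m - 1).
  rewrite -(ler_pM2l m_gt0) [leRHS]mulrCA; apply: le_trans le_m.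
  by rewrite le_eqVlt; apply/orP; left; apply/eqP; ring.
have le1 := bipartite_card_le1 _ _ _ T_ge1 m2 le_m.
case: (ltngtP #|T| #|H :\: K|) => [lt_tm | | e]; first last.
- by left; apply/eqP; rewrite eqEcard sTK e leqnn.
- by rewrite ltnNge le_tm.
have em : m = #|T|%:Z + 1 by move: le1 lt_tm; rewrite /m card_K'; clear; lia.
right; have /eqP/cards1P[z defz] : #|(H :\: K) :\: T| = 1%N.
  rewrite cardsDS // (_ : #|H :\: K| = #|T|.+1) ?subSnn //.
  by apply/eqP; rewrite -eqz_nat -card_K' -/m em -addn1.
have HKz : z \in (H :\: K) :\: T by rewrite defz inE.
have /setDP[/setDP[Hz nKz] nTz] := HKz.
have ntz : z != 1%g by apply: contraNneq nKz => ->.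
have Uz : z \in U by rewrite in_setD nTz in_setD1 ntz.
(* The sets [K] and [U] are stable under conjugation and inversion, hence so is the single element
   [z] missing from [T]. *)
have [Zz oz] : z \in 'Z(H)%g /\ #[z]%g = 2%N.
  apply: invariant_singleton => // [g Hg|]; apply/set1P; rewrite -defz.
    have /setDP[_ nTzg] := conjU z g Uz Hg.
    by rewrite in_setD nTzg in_setD memJ_norm ?nKz ?groupJ // (subsetP
      (normal_norm nKH)).
  have /setDP[_ nTzV] := invU z Uz.
  by rewrite in_setD nTzV in_setD !groupV nKz.
exists z; last by split=> //; rewrite inE nKz.
split; first by have := bipartite_card_eq1 _ _ _ T_ge1 m2 em le_m.
by rewrite -defz setDDr setDv set0U; apply/esym/setIidPr.
Qed.

End KernelExcluded.

End Backward.

Theorem theorem4p1 (gT : finGroupType) (G N H : {group gT}) (q : nat)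
    (pi : gT -> gT) (S : {set gT})
    (frobG : [Frobenius G = N ><| H])
    (q_ge3 : 3 <= q) (cardN : #|N| = q) (cardH : #|H| = q - 1)
    (piE : {in N & H, forall n h, pi (n * h) = h})
    (connS : normal_connection_set G S) :
  let pre (A : {set gT}) : {set gT} := [set x in G | pi x \in A] in
  ramanujan_graph (Cay G S) <->
     S = G :\ 1
  \/ S = G :\: N
  \/ (5 <= q /\
      exists2 z : gT, z \in 'Z(H) /\ #[z] = 2 &
        S = (N :\ 1) :|: pre (H :\: [set 1; z]))
  \/ (exists2 K : {group gT}, K <| H /\ #|H : K| = 2 &
        S = pre (H :\: K))
  \/ (7 <= q /\
      exists (K : {group gT}) (z : gT),
        [/\ K <| H, #|H : K| = 2, z \in 'Z(H) :\: K, #[z] = 2 &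
            S = pre ((H :\: K) :\ z)]).
Proof.
rewrite subn1 in cardH; move=> pre.
have preE A : pre A = pi_preim _ G pi A by [].
split=> [ramS | ].
  have defS : S = (S :&: N) :|: pre (S :&: H).
    exact: conn_setE frobG piE _ connS.
  have sTH : S :&: H \subset H^# := conn_compl_sub _ _ _ _ connS.
  have full_T : H^# :\: (S :&: H) = set0 -> S :&: H = H^#.
    by move/eqP; rewrite setD_eq0 => sHT; apply/eqP; rewrite eqEsubset sTH.
  have [SN | SN] := conn_ker _ _ _ _ _ frobG cardN _ connS cardH; last first.
    rewrite SN in defS.
    have [/full_T defT | [z [q5 defU] [Zz oz]]] :=
        kernel_cases _ _ _ _ _ _ frobG q_ge3 cardN cardH piE _ connS ramS SN.
      by left; rewrite (setD1_pi_preim _ _ _ _ _ frobG piE) defS defT.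
    right; right; left; split=> //; exists z => //.
    rewrite defS; congr (_ :|: pre _).
    by rewrite -setDDl -defU setDDr setDv set0U; apply/esym/setIidPr.
  rewrite SN set0U in defS.
  have [/existsP[K /and3P[nKH /eqP iK sTK]] | /existsPn no_bip] :=
      boolP [exists K : {group gT},
        [&& K <| H, #|H : K| == 2 & S :&: H \subset H :\: K]].
    do 3!right.
    have [defT | [z [q7 defT] [Zz oz]]] := bipartite_case
        _ _ _ _ _ _ frobG q_ge3 cardN cardH piE _ connS ramS SN K nKH iK sTK.
      by left; exists K; rewrite // defS defT.
    by right; split=> //; exists K, z; rewrite defS defT.
  right; left; rewrite (setD_pi_preim _ _ _ _ _ frobG piE) defS -full_T //.
  apply: (nonbipartite_case
    _ _ _ _ _ _ frobG q_ge3 cardN cardH piE _ connS ramS SN) => K nKH iK.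
  by have := no_bip K; rewrite nKH iK.
case=> [defS | [defS | [[q5 [z [Zz oz] defS]] | [[K [nKH iK] defS] |
    [q7 [K [z [nKH iK Zz oz defS]]]]]]]].
- exact: ramanujan_complete frobG cardN piE _ connS q_ge3 cardH defS.
- exact: ramanujan_multipartite frobG cardN piE _ connS q_ge3 cardH defS.
- exact: ramanujan_D1z frobG cardN piE _ connS q_ge3 cardH z q5 Zz oz defS.
- exact: ramanujan_bipartite frobG cardN piE _ connS q_ge3 cardH
    K (normal_sub nKH) iK defS.
- exact: ramanujan_bipartite_D1 frobG cardN piE _ connS q_ge3 cardH
    K z q7 (normal_sub nKH) iK Zz oz defS.
Qed.
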